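(* Let $d\ge1$, let $b:\mathbb R^d\to\mathbb R^d$ be measurable, let $\gamma\in(0,1/2)$, and assume that there are constants $L_0>0$, $\ell_0\ge 0$ with $$|b(x)-b(y)|\le L_0\big(1+|x|^{\ell_0}+|y|^{\ell_0}\big)|x-y|,\qquad x,y\in\mathbb R^d .$$ Consider one of the following two cases. (i) (Tamed Euler–Maruyama scheme.) There are constants $L_1,L_2,L_3,L_4>0$ and $R^*\ge0$ such that for all $x,y\in\mathbb R^d$ $$\big|b(x)|y|^{\ell_0}-b(y)|x|^{\ell_0}\big|\le L_1\big(1+|x|^{\ell_0}+|y|^{\ell_0}+|x|^{\ell_0}|y|^{\ell_0}\big)|x-y|,$$ and for all $x,y\in\mathbb R^d$ with $|x|>R^*$ or $|y|>R^*$ $$\langle x-y,b(x)-b(y)\rangle\le -L_2\big(1+|x|^{\ell_0}+|y|^{\ell_0}\big)|x-y|^2,$$ $$\big\langle x-y,b(x)|y|^{\ell_0}-b(y)|x|^{\ell_0}\big\rangle\le\big(L_3(1+|x|^{\ell_0}+|y|^{\ell_0})-L_4|x|^{\ell_0}|y|^{\ell_0}\big)|x-y|^2 ;$$ and $\mu P^{(\delta)}_{n\delta}$ denotes the law at step $n$ of the tamed Euler–Maruyama scheme (see context) started from $\mu$. (ii) (Projected Euler–Maruyama scheme.) There are constants $R_*>0$ and $L_5=L_5(R_* )>0$ such that for all $x,y\in\mathbb R^d$ with $|x|>R_*$ or $|y|>R_*$ $$\langle x-y,b(x)-b(y)\rangle\le -L_5|x-y|^2 ;$$ and $\mu P^{(\delta)}_{n\delta}$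 denotes the law at step $n$ of the projected Euler–Maruyama scheme (see context) started from $\mu$. Then, in each case, there exist constants $C_0,\sigma_0,\lambda,\delta_1^\star>0$ such that for all $\delta\in(0,\delta_1^\star]$, all integers $n\ge0$, all $\mu,\nu\in\mathscr P_2(\mathbb R^d)$, and every noise intensity $\sigma$ satisfying $|\sigma|\ge\sigma_0$, $$\mathbb W_2\big(\mu P^{(\delta)}_{n\delta},\nu P^{(\delta)}_{n\delta}\big)\le C_0\,e^{-\lambda n\delta}\,\mathbb W_2(\mu,\nu).$$
   Context: $|\cdot|$ and $\langle\cdot,\cdot\rangle$ are the Euclidean norm and inner product on $\mathbb R^d$; $\mathscr P_2(\mathbb R^d)$ is the set of probability measures on $\mathbb R^d$ with finite second moment and $\mathbb W_2$ is the $L^2$-Wasserstein distance on it. $(W_t)_{t\ge0}$ is a $d$-dimensional Brownian motion on a complete filtered probability space $(\Omega,\mathscr F,(\mathscr F_t)_{t\ge0},\mathbb P)$ and $\triangle W_{n\delta}:=W_{(n+1)\delta}-W_{n\delta}$. The schemes discretize the SDE $\mathrm dX_t=b(X_t)\,\mathrm dt+\sigma\,\mathrm dW_t$ with $\sigma\in\mathbb R$ (assumed strongly well-posed), with step size $\delta>0$; initial values are $\mathscr F_0$-measurable. Tamed Euler–Maruyama scheme: $X_{(n+1)\delta}=X_{n\delta}+b^{(\delta)}(X_{n\delta})\delta+\sigma\triangle W_{n\delta}$, with $b^{(\delta)}(x)=\dfrac{b(x)}{1+\delta^\gamma|x|^{\ell_0}}$. Projected Euler–Maruyama scheme: $X_{(n+1)\delta}=\pi^{(\delta)}(X_{n\delta})+b(\pi^{(\delta)}(X_{n\delta}))\delta+\sigma\triangle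 W_{n\delta}$, with $\pi^{(\delta)}(x)=\frac{1}{|x|}\big(|x|\wedge\varphi^{-1}(\delta^{-\gamma})\big)x$ for $x\ne0$, $\pi^{(\delta)}(0)=0$, where $\varphi^{-1}$ is the inverse function of $\varphi(r)=1+r^{\ell_0}$, $r\ge0$, and $\wedge$ denotes minimum. For a probability measure $\mu$ on $\mathbb R^d$, $\mu P^{(\delta)}_{n\delta}$ is the law of $X_{n\delta}$ when $X_0$ has law $\mu$. *)

(* Defs.v *)
From HB Require Import structures.
From mathcomp Require Import all_boot all_order all_algebra.
From mathcomp Require Import all_classical all_reals all_analysis.

Set Implicit Arguments.
Unset Strict Implicit.
Unset Printing Implicit Defensive.

Import Order.TTheory GRing.Theory Num.Theory.
Import numFieldNormedType.Exports.

Local Open Scope classical_set_scope.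
Local Open Scope ring_scope.

(* R^d is 'rV[R]_d with its Borel sigma-algebra. The library norm on matrices
   is the sup norm, hence the Euclidean enorm below; the topology is the same. *)
HB.instance Definition _ (R : realType) (d : nat) :=
  @isMeasurable.Build (sigma_display (@open 'rV[R]_d)) 'rV[R]_d
    <<s @open 'rV[R]_d >> (@sigma_algebra0 _ setT _)
    (fun A => @sigma_algebraC _ _ A) (@sigma_algebra_bigcup _ setT _).

Definition inner (R : realType) (d : nat) (x y : 'rV[R]_d) : R :=
  \sum_(i < d) x ord0 i * y ord0 i.

Definition enorm (R : realType) (d : nat) (x : 'rV[R]_d) : R :=
  Num.sqrt (inner x x).

Definition finite_second_moment (R : realType) (d : nat)
    (mu : probability 'rV[R]_d R) : Prop :=
  (\int[mu]_x (enorm x ^+ 2)%:E < +oo)%E.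

Definition coupling (R : realType) (d : nat) (mu nu : set 'rV[R]_d -> \bar R) :
    set (probability ('rV[R]_d * 'rV[R]_d)%type R) :=
  [set pi | forall A : set 'rV[R]_d, measurable A ->
     pi (A `*` setT) = mu A /\ pi (setT `*` A) = nu A].

Definition W2 (R : realType) (d : nat) (mu nu : set 'rV[R]_d -> \bar R) :
    \bar R :=
  ereal_inf [set ((\int[pi]_z (enorm (z.1 - z.2) ^+ 2)%:E) `^ (2^-1))%E
            | pi in coupling mu nu].

(* Time is indexed by R; only times t >= 0 are constrained. *)
Definition complete_filtration (R : realType) (disp : measure_display)
    (Omega : measurableType disp) (P : probability Omega R)
    (F : R -> set (set Omega)) : Prop :=
  [/\ measure_is_complete P,
      forall t, 0 <= t -> sigma_algebra setT (F t) /\ F t `<=` measurable,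
      forall s t, 0 <= s -> s <= t -> F s `<=` F t
    & P.-negligible `<=` F 0].

Definition measurable_wrt (R : realType) (d : nat) (Omega : Type)
    (G : set (set Omega)) (X : Omega -> 'rV[R]_d) : Prop :=
  forall B : set 'rV[R]_d, measurable B -> G (X @^-1` B).

Definition indep_of (R : realType) (d : nat) (disp : measure_display)
    (Omega : measurableType disp) (P : probability Omega R)
    (G : set (set Omega)) (X : Omega -> 'rV[R]_d) : Prop :=
  forall (A : set Omega) (B : set 'rV[R]_d), G A -> measurable B ->
    P (A `&` X @^-1` B) = (P A * P (X @^-1` B))%E.

(* X ~ N(0, v I_d); boxes determine the law.
   The second argument of normal_prob is the standard deviation. *)
Definition centered_gaussian (R : realType) (d : nat) (disp : measure_display)
    (Omega : measurableType disp) (P : probability Omega R)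
    (v : R) (X : Omega -> 'rV[R]_d) : Prop :=
  forall A : 'I_d -> set R, (forall i, measurable (A i)) ->
    P [set w | forall i, A i (X w ord0 i)] =
    (\prod_(i < d) normal_prob 0 (Num.sqrt v) (A i))%E.

Definition brownian_motion (R : realType) (d : nat) (disp : measure_display)
    (Omega : measurableType disp) (P : probability Omega R)
    (F : R -> set (set Omega)) (W : R -> Omega -> 'rV[R]_d) : Prop :=
  [/\ {ae P, forall w, W 0 w = 0},
      forall t, 0 <= t -> measurable_wrt (F t) (W t),
      forall s t, 0 <= s -> s < t ->
        indep_of P (F s) (fun w => W t w - W s w),
      forall s t, 0 <= s -> s < t ->
        centered_gaussian P (t - s) (fun w => W t w - W s w)
    & {ae P, forall w, {within [set t : R | 0 <= t], continuous (W ^~ w)}}].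

Record brownian_basis (R : realType) (d : nat) := BrownianBasis {
  bb_disp : measure_display ;
  bb_Omega : measurableType bb_disp ;
  bb_P : probability bb_Omega R ;
  bb_F : R -> set (set bb_Omega) ;
  bb_W : R -> bb_Omega -> 'rV[R]_d ;
  bb_filtration : complete_filtration bb_P bb_F ;
  bb_brownian : brownian_motion bb_P bb_F bb_W }.

Arguments bb_P {R d} _.
Arguments bb_F {R d} _ _.
Arguments bb_W {R d} _ _ _.

(* Both schemes have the form X_{n+1} = step X_n + sigma (W_{n+1} - W_n). *)
Fixpoint scheme (R : realType) (d : nat) (step : 'rV[R]_d -> 'rV[R]_d)
    (sigma delta : R) (Omega : Type) (W : R -> Omega -> 'rV[R]_d)
    (X0 : Omega -> 'rV[R]_d) (n : nat) (w : Omega) {struct n} : 'rV[R]_d :=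
  if n is m.+1 then
    step (scheme step sigma delta W X0 m w)
    + sigma *: (W (m.+1%:R * delta) w - W (m%:R * delta) w)
  else X0 w.

Definition tamed_drift (R : realType) (d : nat) (b : 'rV[R]_d -> 'rV[R]_d)
    (gamma l0 delta : R) (x : 'rV[R]_d) : 'rV[R]_d :=
  (1 + delta `^ gamma * enorm x `^ l0)^-1 *: b x.

Definition tamed_step (R : realType) (d : nat) (b : 'rV[R]_d -> 'rV[R]_d)
    (gamma l0 delta : R) (x : 'rV[R]_d) : 'rV[R]_d :=
  x + delta *: tamed_drift b gamma l0 delta x.

Definition phi (R : realType) (l0 r : R) : R := 1 + r `^ l0.

Definition phi_inv (R : realType) (l0 : R) : R -> R :=
  'pinv_(fun=> 0) [set r : R | 0 <= r] (phi l0).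

(* For l0 = 0 the function phi is constant and has no inverse; the truncation
   radius is then read as +oo, i.e. nothing is truncated (for l0 > 0 the
   radius phi_inv (delta `^ - gamma) tends to +oo as l0 decreases to 0 once
   delta `^ - gamma > 2). *)
Definition projection (R : realType) (d : nat) (gamma l0 delta : R)
    (x : 'rV[R]_d) : 'rV[R]_d :=
  if x == 0 then 0 else
  if l0 == 0 then x else
  ((enorm x)^-1 * Num.min (enorm x) (phi_inv l0 (delta `^ (- gamma)))) *: x.

Definition projected_step (R : realType) (d : nat)
    (b : 'rV[R]_d -> 'rV[R]_d) (gamma l0 delta : R) (x : 'rV[R]_d) :
    'rV[R]_d :=
  projection gamma l0 delta x + delta *: b (projection gamma l0 delta x).

(* rho is the law of X_{n delta} when X_0 has law mu. The law does not depend
   on the filtered probability space carrying the Brownian motion, so any space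
   with an F_0-measurable initial value of law mu may be used. *)
Definition scheme_law (R : realType) (d : nat) (step : 'rV[R]_d -> 'rV[R]_d)
    (sigma delta : R) (n : nat) (mu rho : set 'rV[R]_d -> \bar R) : Prop :=
  exists (B : brownian_basis R d) (X0 : bb_Omega B -> 'rV[R]_d),
    [/\ measurable_wrt (bb_F B 0) X0,
        forall A, measurable A -> pushforward (bb_P B) X0 A = mu A
      & rho = pushforward (bb_P B) (scheme step sigma delta (bb_W B) X0 n)].

Definition W2_contraction (R : realType) (d : nat)
    (step : R -> 'rV[R]_d -> 'rV[R]_d) : Prop :=
  exists C0 sigma0 lambda delta1 : R,
    [/\ 0 < C0, 0 < sigma0, 0 < lambda & 0 < delta1] /\
    forall (delta : R) (n : nat) (mu nu : probability 'rV[R]_d R) (sigma : R),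
      0 < delta -> delta <= delta1 ->
      finite_second_moment mu -> finite_second_moment nu ->
      sigma0 <= `|sigma| ->
      forall rho rho' : set 'rV[R]_d -> \bar R,
        scheme_law (step delta) sigma delta n mu rho ->
        scheme_law (step delta) sigma delta n nu rho' ->
        (W2 rho rho' <=
           (C0 * expR (- (lambda * n%:R * delta)))%:E * W2 mu nu)%E.

(* Main.v *)
Require Import Defs.
From mathcomp Require Import all_boot all_order all_algebra.
From mathcomp Require Import all_classical all_reals all_analysis.
From mathcomp Require Import measurable_realfun ring lra.

Set Implicit Arguments.
Unset Strict Implicit.
Unset Printing Implicit Defensive.

Import Order.TTheory GRing.Theory Num.Theory.
Import numFieldNormedType.Exports.

Local Open Scope classical_set_scope.
Local Open Scope ring_scope.

(* Couple two copies of the scheme synchronously, i.e. with the same noise. One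
   step contracts |x - y|^2 by 1 - c delta, except that x in a fixed ball B costs
   a factor 1 + K delta. So it suffices to find a weight V with values in [1, 2]
   such that (1 - c delta + K delta 1_B(x)) E V(step x + sigma xi) is at most
   (1 - c delta / 2) V(x); then V(x) |x - y|^2 contracts along the coupling.
   If sigma^2 delta is large, a single increment leaves B with high probability
   and V = 1 + O(delta) 1_B works. Otherwise V = 1 + h(|x|_sup) / sigma^2, where h
   is compactly supported, strongly concave near B and has second derivative at
   most 2e elsewhere: the noise then decreases V on B at rate O(1), however large
   sigma is, while the drift only contributes O(sigma^-2) because h is compactly
   supported. The sup norm reduces the Gaussian estimate to one coordinate, namely
   one attaining the norm, since h is nonincreasing. *)

(** * Borel sets of row vectors *)

(** The obstacle is uniformity: for all noise levels above [sigma0] at once, sigma^2 delta can be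
    arbitrarily small or arbitrarily large. A second-order expansion of E V(step x + sigma xi)
    serves only the first range, which is why two weights are needed.

    The weight may depend on x alone because the shared noise cancels in the difference: given (x,
    y), the next distance is deterministic and leaves the expectation, so that only E V(step x +
    sigma xi) remains.

    The one-step bound rests on |z + delta u|^2 = |z|^2 + 2 delta <z, u> + delta^2 |u|^2. Taming or
    projecting makes the effective Lipschitz constant of the drift O(delta^-gamma), so the last term
    is O(delta^(1 - 2 gamma)) times delta |z|^2; since gamma < 1/2 it takes only part of the
    dissipation in the middle term.

    Values of V in [1, 2] yield C0 = sqrt 2, and the square root in W2 turns the rate c / 2 into
    lambda = c / 4. *)

Section law.
Context (d1 d2 : measure_display) (T1 : measurableType d1)
  (T2 : measurableType d2) (R : realType).
Variables (P : probability T1 R) (f : T1 -> T2) (mf : measurable_fun setT f).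

Definition law : probability T2 R := distribution P (mfun_Sub (mem_set mf)).

Lemma lawE (A : set T2) : law A = P (f @^-1` A).
Proof. by []. Qed.

Lemma ge0_integral_law (h : T2 -> \bar R) :
  measurable_fun setT h -> (forall y, 0 <= h y)%E ->
  (\int[law]_y h y = \int[P]_x h (f x))%E.
Proof. by move=> mh h0; rewrite ge0_integral_distribution. Qed.

End law.

(** A pi-system generating the Borel sets, and the sets on which [centered_gaussian] prescribes the
    law. *)
Definition boxes (R : realType) (d : nat) : set (set 'rV[R]_d) :=
  [set A | exists a : 'I_d -> set R,
     (forall i, measurable (a i)) /\ A = [set x : 'rV[R]_d | forall i, a i (x ord0 i)]].

Lemma open_measurable_rV (R : realType) (d : nat) (U : set 'rV[R]_d) :
  open U -> measurable U.
Proof. exact: sub_sigma_algebra. Qed.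

Lemma continuous_measurable_rV (R : realType) (d : nat) (f : 'rV[R]_d -> R) :
  continuous f -> measurable_fun setT f.
Proof.
move=> /continuousP cf; apply: (measurability _ (RGenOInfty.measurableE R)).
move=> _ [_ [r ->] <-]; rewrite setTI.
by apply: open_measurable_rV; apply: cf; exact: interval_open.
Qed.

Lemma continuous_measurable_rV_rV (R : realType) (d e : nat)
  (f : 'rV[R]_d -> 'rV[R]_e) : continuous f -> measurable_fun setT f.
Proof.
move=> /continuousP cf; apply: (measurability (@open 'rV[R]_e)) => //.
move=> _ [U oU <-]; rewrite setTI.
by apply: open_measurable_rV; exact: cf.
Qed.

Lemma measurable_coord (R : realType) (d : nat) (i : 'I_d) :
  measurable_fun setT (fun x : 'rV[R]_d => x ord0 i).
Proof. exact: (continuous_measurable_rV (@coord_continuous R _ _ ord0 i)). Qed.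

Lemma measurable_forall_ord (disp : measure_display) (T : measurableType disp)
    (d : nat) (A : 'I_d -> set T) :
  (forall i, measurable (A i)) -> measurable [set x | forall i, A i x].
Proof.
move=> mA; rewrite (_ : [set x | _] = \bigcap_(i in [set: 'I_d]) A i).
  by apply: fin_bigcap_measurable => //; exact: finite_finset.
by apply/seteqP; split => x /= h i *; exact: h.
Qed.

(** Open cubes with rational centre and radius 1/(n+1): the index type is countable, so every open
    set is a countable union of boxes. *)
Lemma open_bigcup_box (R : realType) (d : nat) (U : set 'rV[R]_d) : open U ->
  U = \bigcup_(p in [set p : 'rV[rat]_d * nat |
        [set x : 'rV[R]_d | forall i, `|x ord0 i - ratr (p.1 ord0 i)| < p.2.+1%:R^-1]
          `<=` U])
        [set x : 'rV[R]_d | forall i, `|x ord0 i - ratr (p.1 ord0 i)| < p.2.+1%:R^-1].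
Proof.
move=> oU; apply/seteqP; split => [x Ux|x [p pU]]; last exact: pU.
have /nbhs_ballP[e e0 xeU] : nbhs x U by exact: open_nbhs_nbhs.
have [n ne] : exists n : nat, n.+1%:R^-1 < e / 2.
  have /ltr_add_invr[n] : 0 < e / 2 by rewrite divr_gt0.
  by rewrite add0r; exists n.
have n0 : 0 < n.+1%:R^-1 :> R by rewrite invr_gt0.
have /(_ _)/cid-/all_sig[q qP] (i : 'I_d) :
    exists q : rat, `|x ord0 i - ratr q| < n.+1%:R^-1.
  have /rat_in_itvoo[q] : x ord0 i < x ord0 i + n.+1%:R^-1 by rewrite ltrDl.
  rewrite in_itv/= => /andP[q1 q2]; exists q.
  by rewrite distrC ger0_norm ?subr_ge0 1?ltW// ltrBlDl.
exists (\row_i q i, n) => /=; last by move=> i; rewrite mxE.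
move=> y /= hy; apply: xeU; split => // i j; rewrite (ord1 i).
rewrite /ball/= -(subrKA (ratr (q j))).
rewrite (le_lt_trans (ler_normD _ _))// (splitr e) ltrD//.
  exact: lt_trans ne.
by rewrite distrC; have := hy j; rewrite mxE => /lt_trans; exact.
Qed.

(** The Borel sigma-algebra is the product one, so measurability into R^d can be checked
    coordinatewise. *)
Lemma measurable_rV_boxes (R : realType) (d : nat) :
  @measurable _ 'rV[R]_d = <<s @boxes R d >>.
Proof.
apply/seteqP; split.
  apply: smallest_sub; first exact: smallest_sigma_algebra.
  move=> U oU; rewrite (open_bigcup_box oU).
  rewrite bigcup_mkcond.
  apply: (@countable_bigcupT_measurable _ (g_sigma_algebraType (@boxes R d))) => //.
  move=> p; case: ifPn => // _; apply: sub_sigma_algebra.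
  exists (fun i => [set y | `|y - ratr (p.1 ord0 i)| < p.2.+1%:R^-1]); split => //.
  move=> i; rewrite (_ : [set y | _] = ball (ratr (p.1 ord0 i) : R) p.2.+1%:R^-1).
    exact: measurable_ball.
  by apply/seteqP; split => y; rewrite /ball/= distrC.
apply: smallest_sub; first exact: sigma_algebra_measurable.
move=> _ [a [ma ->]]; apply: measurable_forall_ord => i.
by rewrite -[X in measurable X]setTI; exact: measurable_coord.
Qed.

Lemma measurable_fun_rV (R : realType) (d : nat) (disp : measure_display)
    (T : measurableType disp) (f : T -> 'rV[R]_d) :
  (forall i, measurable_fun setT (fun t => f t ord0 i)) -> measurable_fun setT f.
Proof.
move=> mf; apply: (measurability _ (@measurable_rV_boxes R d)).
move=> _ [_ [a [ma ->]] <-]; rewrite setTI.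
apply: (@measurable_forall_ord _ _ _ (fun i => (fun t => f t ord0 i) @^-1` a i)) => i.
by rewrite -[X in measurable X]setTI; exact: mf.
Qed.

Lemma measurable_coord_comp (R : realType) (d : nat) (disp : measure_display)
    (T : measurableType disp) (f : T -> 'rV[R]_d) (i : 'I_d) :
  measurable_fun setT f -> measurable_fun setT (fun t => f t ord0 i).
Proof. by move=> mf; apply: (measurableT_comp (measurable_coord i)). Qed.

Lemma measurable_rVD (R : realType) (d : nat) (disp : measure_display)
    (T : measurableType disp) (f g : T -> 'rV[R]_d) :
  measurable_fun setT f -> measurable_fun setT g ->
  measurable_fun setT (fun t => f t + g t).
Proof.
move=> mf mg; apply: measurable_fun_rV => i.
under eq_fun do rewrite mxE.
by apply: measurable_funD; exact: measurable_coord_comp.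
Qed.

Lemma measurable_rVZ (R : realType) (d : nat) (disp : measure_display)
    (T : measurableType disp) (k : T -> R) (f : T -> 'rV[R]_d) :
  measurable_fun setT k -> measurable_fun setT f ->
  measurable_fun setT (fun t => k t *: f t).
Proof.
move=> mk mf; apply: measurable_fun_rV => i.
under eq_fun do rewrite mxE.
by apply: measurable_funM => //; exact: measurable_coord_comp.
Qed.

Lemma measurable_rVB (R : realType) (d : nat) (disp : measure_display)
    (T : measurableType disp) (f g : T -> 'rV[R]_d) :
  measurable_fun setT f -> measurable_fun setT g ->
  measurable_fun setT (fun t => f t - g t).
Proof.
move=> mf mg; apply: measurable_fun_rV => i.
under eq_fun do rewrite !mxE.
by apply: measurable_funB; exact: measurable_coord_comp.
Qed.

Lemma measurable_enorm (R : realType) (d : nat) :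
  measurable_fun setT (@enorm R d).
Proof.
apply: (measurableT_comp (continuous_measurable_fun (@sqrt_continuous R))).
rewrite /inner; apply: measurable_sum => i.
by apply: measurable_funM; exact: measurable_coord.
Qed.

Lemma measurable_sup_norm (R : realType) (d : nat) :
  measurable_fun setT (fun x : 'rV[R]_d => `|x|).
Proof. by apply: continuous_measurable_rV; exact: norm_continuous. Qed.

(** Boxes are stable under intersection and generate. This identifies the increment laws of
    different Brownian bases. *)
Lemma probability_rV_unique (R : realType) (d : nat)
    (m1 m2 : probability 'rV[R]_d R) :
  (forall a : 'I_d -> set R, (forall i, measurable (a i)) ->
     m1 [set x : 'rV[R]_d | forall i, a i (x ord0 i)] =
     m2 [set x : 'rV[R]_d | forall i, a i (x ord0 i)]) ->
  forall A, measurable A -> m1 A = m2 A.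
Proof.
move=> h A mA.
apply: (measure_unique (@boxes R d) (fun=> setT)) => //.
- exact: measurable_rV_boxes.
- move=> _ _ [a [ma ->]] [b [mb ->]]; exists (fun i => a i `&` b i).
  split; first by move=> i; exact: measurableI.
  apply/seteqP; split => x /=; first by case=> hx hy i; split.
  by move=> hx; split => i; have [] := hx i.
- move=> _; exists (fun=> setT); split => //.
  by apply/seteqP; split.
- by rewrite bigcup_const.
- by move=> _ [a [ma ->]]; exact: h.
- by move=> _; apply: le_lt_trans (probability_le1 m1 _) (ltry _).
Qed.

Lemma integral_cst_probability (disp : measure_display)
    (T : measurableType disp) (R : realType) (P : probability T R) (k : R) :
  (\int[P]_x k%:E = k%:E)%E.
Proof.
by rewrite integral_cst// -[RHS]mule1; congr (_ * _)%E; exact: probability_setT.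
Qed.

(** * A radial profile *)

Section profile.
Variables (R : realType) (K e r S : R).
Hypotheses (K0 : 0 < K) (e0 : 0 < e) (r0 : 0 < r) (hS : e * (S - r) = K * r).

(** Value at the origin for which the two parabolas of [profile] meet at [r]; [hS] equates their
    slopes there, -2Kr and -2e(S - r). *)
Definition profile_top : R := K * r ^+ 2 + e * (S - r) ^+ 2.

(* C^1 profile on a >= 0 with second derivative -2K up to r, 2e from r to S. *)
Definition profile (a : R) : R :=
  if a <= r then profile_top - K * a ^+ 2 else
  if a <= S then e * (S - a) ^+ 2 else 0.

Lemma profile_rS : r < S.
Proof. by rewrite -subr_gt0 -(pmulr_rgt0 _ e0) hS mulr_gt0. Qed.

Lemma profile_ge0 a : 0 <= a -> 0 <= profile a.
Proof.
move=> a0; rewrite /profile; case: ifPn => [ar|_].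
  have : e * (S - r) ^+ 2 >= 0 by rewrite mulr_ge0 ?sqr_ge0 ?ltW.
  have : K * a ^+ 2 <= K * r ^+ 2 by rewrite ler_pM2l// ler_sqr ?nnegrE// ltW.
  by rewrite /profile_top; lra.
by case: ifPn => // _; rewrite mulr_ge0 ?sqr_ge0 ?ltW.
Qed.

Lemma profile_nonincreasing a b : 0 <= a -> a <= b -> profile b <= profile a.
Proof.
move=> a0 ab; have rS := profile_rS; rewrite /profile /profile_top.
case: (leP b r) => br; case: (leP a r) => ar.
- have : K * a ^+ 2 <= K * b ^+ 2.
    by rewrite ler_pM2l// ler_sqr ?nnegrE// (le_trans a0).
  by lra.
- by lra.
- have : K * a ^+ 2 <= K * r ^+ 2 by rewrite ler_pM2l// ler_sqr ?nnegrE// ltW.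
  have : 0 <= e * (S - r) ^+ 2 by rewrite mulr_ge0 ?sqr_ge0 ?ltW.
  case: (leP b S) => bS; last by lra.
  have : e * (S - b) ^+ 2 <= e * (S - r) ^+ 2.
    by rewrite ler_pM2l// ler_sqr ?nnegrE ?subr_ge0//; lra.
  by lra.
- case: (leP b S) => bS.
    rewrite (le_trans ab bS) ler_pM2l// ler_sqr ?nnegrE ?subr_ge0//; lra.
  by case: ifPn => // _; rewrite mulr_ge0 ?sqr_ge0 ?ltW.
Qed.

(** The slope is steepest at the junction [r], where it equals -2Kr. *)
Lemma profile_lipschitz a b : 0 <= a -> 0 <= b ->
  profile a <= profile b + 2 * K * r * `|a - b|.
Proof.
move=> a0 b0; have rS := profile_rS.
have Kr0 : 0 < K * r by rewrite mulr_gt0.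
have [ab|ba] := leP a b; last first.
  rewrite (le_trans (profile_nonincreasing b0 (ltW ba)))// lerDl.
  by rewrite mulr_ge0// -mulrA mulr_ge0// ltW.
rewrite ler0_norm ?subr_le0// opprB.
have h1 x y : 0 <= x -> x <= y -> y <= r ->
    K * y ^+ 2 - K * x ^+ 2 <= 2 * K * r * (y - x).
  move=> x0 xy yr.
  have : 0 <= K * ((y - x) * (2 * r - (x + y))).
    by apply: mulr_ge0; [exact: ltW|apply: mulr_ge0; lra].
  by lra.
have h2 x y : r <= x -> x <= y ->
    e * (S - x) ^+ 2 - e * (S - y) ^+ 2 <= 2 * K * r * (y - x).
  move=> rx xy.
  have : 0 <= e * ((y - x) * (2 * (S - r) - (2 * S - x - y))).
    by apply: mulr_ge0; [exact: ltW|apply: mulr_ge0; lra].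
  have -> : 2 * K * r * (y - x) = 2 * (e * (S - r)) * (y - x) by rewrite hS; ring.
  by lra.
rewrite /profile /profile_top.
have [br|br] := leP b r.
  by rewrite (le_trans ab br); have := h1 a b a0 ab br; lra.
have [ar|ar] := leP a r.
  have := h1 a r a0 ar (lexx _).
  have [bS|bS] := leP b S; first by have := h2 r b (lexx _) (ltW br); lra.
  have := h2 r S (lexx _) (ltW rS).
  have : 0 <= K * r * (b - S) by apply: mulr_ge0; [exact: ltW|rewrite subr_ge0 ltW].
  by rewrite subrr; lra.
have [bS|bS] := leP b S.
  by rewrite (le_trans ab bS); have := h2 a b (ltW ar) ab; lra.
have [aS|aS] := leP a S.
  have := h2 a S (ltW ar) aS.
  have : 0 <= K * r * (b - S) by apply: mulr_ge0; [exact: ltW|rewrite subr_ge0 ltW].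
  by rewrite subrr; lra.
have : 0 <= K * r * (b - a) by apply: mulr_ge0; [exact: ltW|rewrite subr_ge0].
by lra.
Qed.

Lemma profile_le_top a : 0 <= a -> profile a <= profile_top.
Proof.
move=> a0; apply: le_trans (profile_nonincreasing (lexx 0) a0) _.
by rewrite /profile (ltW r0) expr2; lra.
Qed.

(* Tangent-parabola form of the bound 2e on the second derivative. *)
Lemma profile_le_parabola (p x : R) : `|p| <= r ->
  profile `|x| <= profile_top - K * x ^+ 2 + (K + e) * (x - p) ^+ 2.
Proof.
move=> pr; have rS := profile_rS.
have Ke : 0 <= K + e by rewrite addr_ge0 ?ltW.
have [xr|xr] := leP `|x| r.
  rewrite /profile xr real_normK ?num_real// lerDl mulr_ge0 ?sqr_ge0//.
have h1 : (`|x| - r) ^+ 2 <= (x - p) ^+ 2.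
  have xp : `|x| <= `|x - p| + `|p| by rewrite -{1}(subrK p x) ler_normD.
  rewrite -(real_normK (num_real (x - p))) ler_sqr ?nnegrE//; lra.
have h2 : (K + e) * (`|x| - r) ^+ 2 <= (K + e) * (x - p) ^+ 2 by exact: ler_wpM2l.
have h3 : profile `|x| <= e * (S - `|x|) ^+ 2.
  rewrite /profile (lt_geF xr); case: ifPn => // _.
  by rewrite mulr_ge0 ?sqr_ge0 ?ltW.
(* The parabola tangent at [r] is the outer parabola up to a multiple of e(S - r) - Kr, which
   vanishes by [hS]. *)
have h4 : e * (S - `|x|) ^+ 2 =
    profile_top - K * `|x| ^+ 2 + (K + e) * (`|x| - r) ^+ 2
    + 2 * (e * (S - r) - K * r) * (r - `|x|) by rewrite /profile_top; ring.
rewrite -(real_normK (num_real x)).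
by move: h4; rewrite hS subrr mulr0 mul0r addr0; lra.
Qed.

(** For p = r the bound of [profile_le_parabola] is exactly the outer parabola, which therefore
    dominates on the inner part as well. *)
Lemma profile_le_outer_parabola (x : R) : profile `|x| <= e * (S - `|x|) ^+ 2.
Proof.
have [xr|xr] := leP `|x| r; last first.
  rewrite /profile (lt_geF xr); case: ifPn => // _.
  by rewrite mulr_ge0 ?sqr_ge0 ?ltW.
have := @profile_le_parabola r `|x|; rewrite normr_id (gtr0_norm r0) => /(_ (lexx _)).
have -> : profile_top - K * `|x| ^+ 2 + (K + e) * (`|x| - r) ^+ 2 =
  e * (S - `|x|) ^+ 2 + 2 * (K * r - e * (S - r)) * (r - `|x|).
  by rewrite /profile_top; ring.
by rewrite hS subrr mulr0 mul0r addr0.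
Qed.

(** Averaging over z and -z cancels the first-order term. The second difference costs at most 2e z^2
    everywhere; when a and |z| are at most r/2, both a + z and a - z stay where the profile is
    exactly quadratic, and the concavity -2K is kept in full. *)
Lemma profile_second_difference (a z : R) : 0 <= a ->
  profile `|a + z| + profile `|a - z|
    + 2 * (K + e) * (z ^+ 2 * ((a <= r / 2) && (`|z| <= r / 2))%:R)
  <= 2 * profile a + 2 * e * z ^+ 2.
Proof.
move=> a0; have rS := profile_rS.
have [ar|ar] := leP a r; last first.
  have -> : (a <= r / 2) = false by apply/negbTE; rewrite -ltNge; lra.
  rewrite /= !mulr0 addr0.
  have [aS|aS] := leP a S.
    have out x : profile `|x| <= e * (S - x) ^+ 2.
      have [xS|xS] := leP `|x| S.
        apply: le_trans (profile_le_outer_parabola x) _.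
        rewrite ler_pM2l// ler_sqr ?nnegrE ?lerD2l ?lerN2 ?ler_norm ?subr_ge0//.
        exact: le_trans (ler_norm _) xS.
      rewrite /profile (lt_geF (lt_trans rS xS)) (lt_geF xS).
      by rewrite mulr_ge0 ?sqr_ge0 ?ltW.
    have := out (a + z); have := out (a - z).
    have -> : profile a = e * (S - a) ^+ 2 by rewrite /profile (lt_geF ar) aS.
    by lra.
  have -> : profile a = 0 by rewrite /profile (lt_geF ar) (lt_geF aS).
  have out x : profile `|a + x| <= e * x ^+ 2.
    have [xS|xS] := leP `|a + x| S; last first.
      rewrite /profile (lt_geF (lt_trans rS xS)) (lt_geF xS).
      by rewrite mulr_ge0 ?sqr_ge0 ?ltW.
    apply: le_trans (profile_le_outer_parabola _) _.
    rewrite ler_pM2l// -(real_normK (num_real x)) ler_sqr ?nnegrE ?subr_ge0//.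
    have : a <= `|a + x| + `|x|.
      by rewrite -{1}(ger0_norm a0) -{1}(addrK x a) (le_trans (ler_normB _ _)).
    by lra.
  by have := out z; have := out (- z); rewrite sqrrN; lra.
have bE : profile a = profile_top - K * a ^+ 2 by rewrite /profile ar.
have [/andP[a2 z2]|_] := boolP ((a <= r / 2) && (`|z| <= r / 2)).
  have inner x : `|x| <= r / 2 -> profile `|a + x| = profile_top - K * (a + x) ^+ 2.
    move=> x2; rewrite /profile (_ : `|a + x| <= r) ?real_normK ?num_real//.
    by rewrite (le_trans (ler_normD _ _))// (ger0_norm a0); lra.
  rewrite inner// inner ?normrN// bE mulr1; lra.
rewrite !mulr0 addr0.
have ar' : `|a| <= r by rewrite ger0_norm.
have := @profile_le_parabola a (a + z) ar'; have := @profile_le_parabola a (a - z) ar'.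
by rewrite bE; lra.
Qed.

End profile.

(** * The centered normal law on the line *)

Import HBNNSimple.

(** Checked on nonnegative simple functions, then extended by monotone convergence on both sides. *)
Lemma ge0_integral_density (disp : measure_display) (T : measurableType disp)
    (R : realType) (l m : {measure set T -> \bar R}) (g : T -> R)
    (f : T -> \bar R) :
  measurable_fun setT g -> (forall x, 0 <= g x) ->
  (forall A, measurable A -> m A = \int[l]_(x in A) (g x)%:E)%E ->
  measurable_fun setT f -> (forall x, 0 <= f x)%E ->
  (\int[m]_x f x = \int[l]_x (f x * (g x)%:E))%E.
Proof.
move=> mg g0 mE mf f0.
have mg' : measurable_fun setT (EFin \o g) by exact/measurable_EFinP.
have sE (h : {nnsfun T >-> R}) :
    (\int[m]_x (h x)%:E = \int[l]_x ((h x)%:E * (g x)%:E))%E.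
  under eq_integral do rewrite fimfunE -fsumEFin//.
  rewrite ge0_integral_fsum//; last 2 first.
    - by move=> r; exact/measurable_EFinP/measurableT_comp.
    - by move=> n x _; rewrite EFinM nnfun_muleindic_ge0.
  under [RHS]eq_integral.
    move=> x _; rewrite fimfunE -fsumEFin// ge0_mule_fsuml; last first.
      by move=> r; rewrite EFinM nnfun_muleindic_ge0.
    over.
  rewrite [RHS]ge0_integral_fsum//; last 2 first.
    - by move=> r; apply: emeasurable_funM => //; exact/measurable_EFinP/measurableT_comp.
    - move=> n x _; apply: mule_ge0; last by rewrite lee_fin.
      by rewrite EFinM nnfun_muleindic_ge0.
  apply: eq_fsbigr => r rh.
  have r0 : 0 <= r by move: rh; rewrite inE => -[x _ <-].
  under eq_integral do rewrite EFinM.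
  under [RHS]eq_integral do rewrite EFinM -muleA.
  rewrite !ge0_integralZl ?lee_fin//.
  - rewrite integral_indic//= setIT mE// integral_mkcond; congr (_ * _)%E.
    apply: eq_integral => x _; rewrite patchE indicE.
    by case: ifPn => _; rewrite ?mul1e ?mul0e.
  - apply: emeasurable_funM => //; exact/measurable_EFinP/measurable_indic.
  - by move=> x _; rewrite -EFinM lee_fin mulr_ge0.
  - exact/measurable_EFinP/measurable_indic.
pose f_ := nnsfun_approx measurableT mf.
transitivity (lim (\int[m]_x (f_ n x)%:E @[n --> \oo])%E).
  rewrite -monotone_convergence//=.
  - by apply: eq_integral => x _; apply/esym/cvg_lim => //; exact: cvg_nnsfun_approx.
  - by move=> n; exact/measurable_EFinP.
  - by move=> n x _; rewrite lee_fin.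
  - by move=> x _ a b ab; rewrite lee_fin; exact/lefP/nd_nnsfun_approx.
under eq_fun do rewrite sE.
rewrite -monotone_convergence//=.
- apply: eq_integral => x _; apply/cvg_lim => //.
  by apply: cvgeZr => //; exact: cvg_nnsfun_approx.
- by move=> n; apply: emeasurable_funM => //; exact/measurable_EFinP.
- by move=> n x _; rewrite -EFinM lee_fin mulr_ge0.
- move=> x _ a b ab; rewrite -!EFinM lee_fin ler_wpM2r//.
  exact/lefP/nd_nnsfun_approx.
Qed.

Lemma normal_peakE (R : realType) (s : R) : 0 < s ->
  normal_peak s = (Num.sqrt (2 * pi))^-1 / s.
Proof.
move=> s0; rewrite /normal_peak -mulrnAr sqrtrM ?sqr_ge0// sqrtr_sqr gtr0_norm//.
by rewrite invfM mulrC mulr_natl.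
Qed.

Section centered_normal.
Variables (R : realType) (s : R).
Hypothesis s0 : 0 < s.

Lemma normal_prob_opp (A : set R) : measurable A ->
  normal_prob 0 s (-%R @^-1` A) = normal_prob 0 s A.
Proof.
move=> mA; rewrite /normal_prob.
have pdfN x : normal_pdf 0 s (- x) = normal_pdf 0 s x :> R.
  by rewrite !normal_pdfE ?gt_eqF// /normal_fun !subr0 sqrrN.
under eq_integral do rewrite -pdfN.
rewrite -(@ge0_integral_pushforward _ _ (measurableTypeR R) (measurableTypeR R)
   R -%R _ lebesgue_measure A (fun x => (normal_pdf 0 s x)%:E))//.
- by apply: eq_measure_integral => B mB _; exact: lebesgue_measureN.
- by apply/measurable_EFinP/measurable_funTS; exact: measurable_normal_pdf.
- by move=> y _; rewrite lee_fin normal_pdf_ge0.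
Qed.

Lemma ge0_integral_normal_opp (f : R -> \bar R) :
  measurable_fun setT f -> (forall x, 0 <= f x)%E ->
  (\int[normal_prob 0 s]_x f (- x)%R = \int[normal_prob 0 s]_x f x)%E.
Proof.
move=> mf f0.
rewrite -[LHS](@ge0_integral_pushforward _ _ (measurableTypeR R) (measurableTypeR R)
  R -%R _ (normal_prob 0 s) setT f)//.
by apply: eq_measure_integral => B mB _; exact: normal_prob_opp.
Qed.

(* [u^2 exp(-u^2/2s^2) <= 4 s^2 exp(-u^2/4s^2)], whose right-hand side is a
   multiple of the density of N(0, 2 s^2). *)
Lemma normal_second_moment_le :
  (\int[normal_prob 0 s]_u (u ^+ 2)%:E <= (8 * s ^+ 2)%:E)%E.
Proof.
have ms : measurable_fun setT (normal_pdf 0 s) by exact: measurable_normal_pdf.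
rewrite (@ge0_integral_density _ _ _ lebesgue_measure _ (normal_pdf 0 s))//;
  last 3 first.
- by move=> x; exact: normal_pdf_ge0.
- by apply/measurable_EFinP; exact: measurable_funX.
- by move=> x; rewrite lee_fin sqr_ge0.
pose s' := Num.sqrt 2 * s.
have s'0 : 0 < s' by rewrite mulr_gt0 ?sqrtr_gt0.
have s'2 : s' ^+ 2 = 2 * s ^+ 2 by rewrite exprMn sqr_sqrtr.
have pi0 := pi_gt0 R.
(* Renormalising to variance 2 s^2 costs sqrt 2, rounded up to 2; hence 8 in place of 4. *)
have peakE : normal_peak s = Num.sqrt 2 * normal_peak s'.
  rewrite !normal_peakE// /s'; field.
  by rewrite !gt_eqF ?sqrtr_gt0 ?mulr_gt0.
have le2 : Num.sqrt 2 <= 2 :> R.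
  by rewrite -ler_sqr ?nnegrE ?sqrtr_ge0// sqr_sqrtr//; lra.
have le1 x : x ^+ 2 * normal_pdf 0 s x <= 8 * s ^+ 2 * normal_pdf 0 s' x.
  rewrite !normal_pdfE ?gt_eqF// /normal_fun !subr0 s'2 peakE.
  pose t := x ^+ 2 / (4 * s ^+ 2).
  have ss0 : s ^+ 2 != 0 by rewrite sqrf_eq0 gt_eqF.
  have -> : - x ^+ 2 / (s ^+ 2 *+ 2) = - t - t.
    by rewrite /t; field; exact: lt0r_neq0.
  have -> : - x ^+ 2 / (2 * s ^+ 2 *+ 2) = - t.
    by rewrite /t; field; exact: lt0r_neq0.
  have -> : x ^+ 2 = 4 * s ^+ 2 * t by rewrite /t; field; exact: lt0r_neq0.
  rewrite expRD.
  have t1 : t * expR (- t) <= 1.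
    rewrite expRN ler_pdivrMr ?expR_gt0// mul1r.
    by apply: le_trans (expR_ge1Dx t); rewrite lerDr.
  have := normal_peak_gt0 (lt0r_neq0 s'0).
  have := expR_gt0 (- t).
  set E := expR (- t) => E0; set p := normal_peak s' => p0.
  have -> : 4 * s ^+ 2 * t * (Num.sqrt 2 * p * (E * E)) =
    Num.sqrt 2 * (t * E) * (4 * s ^+ 2 * (p * E)) by ring.
  have -> : 8 * s ^+ 2 * (p * E) = 2 * 1 * (4 * s ^+ 2 * (p * E)) by ring.
  apply: ler_wpM2r; first by rewrite !mulr_ge0 ?sqr_ge0// ltW.
  apply: ler_pM => //.
  by rewrite mulr_ge0 ?(ltW E0)// /t divr_ge0 ?sqr_ge0// mulr_ge0 ?sqr_ge0.
apply: (@le_trans _ _ (\int[lebesgue_measure]_x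
    ((8 * s ^+ 2)%:E * (normal_pdf 0 s' x)%:E))%E).
  apply: ge0_le_integral => //.
  - by move=> x _; rewrite -EFinM lee_fin mulr_ge0 ?sqr_ge0 ?normal_pdf_ge0.
  - under eq_fun do rewrite -EFinM.
    by apply/measurable_EFinP/measurable_funM => //; exact: measurable_funX.
  - under eq_fun do rewrite -EFinM.
    by apply/measurable_EFinP/measurable_funM => //; exact: measurable_normal_pdf.
  - by move=> x _; rewrite -!EFinM lee_fin.
rewrite ge0_integralZl//.
- by rewrite integral_normal_pdf mule1.
- by apply/measurable_EFinP; exact: measurable_normal_pdf.
- by move=> x _; rewrite lee_fin normal_pdf_ge0.
- by rewrite lee_fin mulr_ge0 ?sqr_ge0.
Qed.

Lemma normal_prob_le (A : set R) : measurable A ->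
  (normal_prob 0 s A <= (normal_peak s)%:E * lebesgue_measure A)%E.
Proof.
move=> mA; rewrite /normal_prob -integral_cst//.
apply: ge0_le_integral => //.
- by move=> x _; rewrite lee_fin normal_pdf_ge0.
- by apply/measurable_EFinP/measurable_funTS; exact: measurable_normal_pdf.
- by move=> x _; rewrite lee_fin normal_pdf_ub// gt_eqF.
Qed.

(** The density is at least its peak times exp(-2) on an interval of length [s], and the peak is
    proportional to 1/s: the bound is free of [s]. *)
Lemma normal_prob_shell_ge :
  ((expR (- 2) / Num.sqrt (2 * pi))%:E <= normal_prob 0 s `[s, (2 * s)%R])%E.
Proof.
have -> : expR (- 2) / Num.sqrt (2 * pi) = normal_peak s * expR (- 2) * s.
  by rewrite normal_peakE//; field; rewrite gt_eqF//= gt_eqF// sqrtr_gt0 mulr_gt0 ?pi_gt0.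
rewrite /normal_prob.
have -> : ((normal_peak s * expR (- 2) * s)%:E =
   \int[lebesgue_measure]_(x in `[s, (2 * s)%R]) (normal_peak s * expR (- 2))%:E)%E.
  rewrite integral_cst//= lebesgue_measure_itv/= lte_fin.
  rewrite ifT; last by have := s0; lra.
  by rewrite -EFinB -EFinM; congr (_ * _)%:E; ring.
apply: ge0_le_integral => //.
- by move=> x _; rewrite lee_fin mulr_ge0 ?normal_peak_ge0 ?expR_ge0.
- by apply/measurable_EFinP/measurable_funTS; exact: measurable_normal_pdf.
- move=> x /=; rewrite in_itv/= => /andP[sx x2s].
  rewrite lee_fin normal_pdfE ?gt_eqF// ler_wpM2l ?normal_peak_ge0//.
  rewrite /normal_fun subr0 ler_expR ler_pdivlMr ?mulrn_wgt0 ?exprn_gt0//.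
  rewrite -mulr_natl mulNr lerN2.
  have : x ^+ 2 <= (2 * s) ^+ 2 by rewrite ler_sqr ?nnegrE//; have := s0; lra.
  by rewrite exprMn; lra.
Qed.

End centered_normal.

(** * Euclidean norm *)

Section euclidean.
Variables (R : realType) (d : nat).
Implicit Types (x y : 'rV[R]_d) (k : R).

Lemma innerC x y : inner x y = inner y x.
Proof. by apply: eq_bigr => i _; rewrite mulrC. Qed.

Lemma innerDl x y z : inner (x + y) z = inner x z + inner y z.
Proof.
by rewrite /inner -big_split; apply: eq_bigr => i _; rewrite !mxE mulrDl.
Qed.

Lemma innerZl k x y : inner (k *: x) y = k * inner x y.
Proof. by rewrite /inner mulr_sumr; apply: eq_bigr => i _; rewrite mxE mulrA. Qed.

Lemma innerDr x y z : inner x (y + z) = inner x y + inner x z.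
Proof. by rewrite innerC innerDl !(innerC x). Qed.

Lemma innerZr k x y : inner x (k *: y) = k * inner x y.
Proof. by rewrite innerC innerZl innerC. Qed.

Lemma inner_ge0 x : 0 <= inner x x.
Proof. by apply: sumr_ge0 => i _; rewrite -expr2 sqr_ge0. Qed.

Lemma enorm_ge0 x : 0 <= enorm x.
Proof. exact: sqrtr_ge0. Qed.

Lemma enorm_sqr x : enorm x ^+ 2 = inner x x.
Proof. by rewrite sqr_sqrtr ?inner_ge0. Qed.

Lemma enorm0 : enorm (0 : 'rV[R]_d) = 0.
Proof.
by rewrite /enorm /inner big1 ?sqrtr0// => i _; rewrite mxE mul0r.
Qed.

Lemma enormZ k x : enorm (k *: x) = `|k| * enorm x.
Proof.
by rewrite /enorm innerZl innerZr mulrA -expr2 sqrtrM ?sqr_ge0// sqrtr_sqr.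
Qed.

Lemma enormN x : enorm (- x) = enorm x.
Proof. by rewrite -scaleN1r enormZ normrN normr1 mul1r. Qed.

Lemma enormB x y : enorm (x - y) = enorm (y - x).
Proof. by rewrite -opprB enormN. Qed.

Lemma enormD_sqr x y :
  enorm (x + y) ^+ 2 = enorm x ^+ 2 + 2 * inner x y + enorm y ^+ 2.
Proof. by rewrite !enorm_sqr !innerDl !innerDr (innerC y x); ring. Qed.

Lemma normr_le_enorm x : `|x| <= enorm x.
Proof.
rewrite [leLHS]/Num.norm/=; have [->|/mx_norm_neq0[[i j] ->]] := eqVneq (mx_norm x) 0.
  exact: enorm_ge0.
rewrite /= (ord1 i) -sqrtr_sqr ler_wsqrtr// /inner (bigD1 j)//= -expr2 lerDl.
by apply: sumr_ge0 => k _; rewrite -expr2 sqr_ge0.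
Qed.

Lemma normr_coord_le x i : `|x ord0 i| <= `|x|.
Proof.
rewrite [leRHS]/Num.norm/= mx_normrE.
exact: (le_bigmax _ (fun i : 'I_1 * 'I_d => `|x i.1 i.2|) (ord0, i)).
Qed.

Lemma enorm_le_normr x : enorm x <= Num.sqrt d%:R * `|x|.
Proof.
rewrite -[`|x|]ger0_norm// -sqrtr_sqr -sqrtrM// ler_wsqrtr//.
rewrite mulr_natl -[X in _ *+ X]card_ord -sumr_const.
apply: ler_sum => i _; rewrite -expr2 -real_normK ?num_real//.
by rewrite ler_sqr ?nnegrE// normr_coord_le.
Qed.

Lemma normr_coord_attained x : (0 < d)%N -> exists i, `|x| = `|x ord0 i|.
Proof.
move=> d0; rewrite /Num.norm/=.
have [x0|/mx_norm_neq0[[i j] ->]] := eqVneq (mx_norm x) 0; last first.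
  by exists j; rewrite /= (ord1 i).
exists (Ordinal d0); rewrite x0 (mx_norm_eq0 x0) mxE; by apply/esym/eqP; rewrite normr_eq0.
Qed.

Lemma enorm_eq0 x : enorm x = 0 -> x = 0.
Proof.
by move=> x0; apply/eqP; rewrite -normr_eq0 eq_le normr_ge0 -x0 normr_le_enorm.
Qed.

Lemma cauchy_schwarz x y : inner x y <= enorm x * enorm y.
Proof.
have [x0|x0] := eqVneq (enorm x) 0.
  by rewrite x0 (enorm_eq0 x0) -(scale0r 0) innerZl !mul0r.
have [y0|y0] := eqVneq (enorm y) 0.
  by rewrite y0 (enorm_eq0 y0) -(scale0r 0) innerZr mulr0 mul0r.
have xy0 : 0 < enorm x * enorm y.
  by rewrite mulr_gt0// lt_neqAle enorm_ge0 eq_sym ?x0 ?y0.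
have := sqr_ge0 (enorm (enorm y *: x + (- enorm x) *: y)).
rewrite enormD_sqr !enormZ innerZl innerZr normrN !(ger0_norm (enorm_ge0 _)).
have -> : (enorm y * enorm x) ^+ 2 + 2 * (enorm y * (- enorm x * inner x y)) +
    (enorm x * enorm y) ^+ 2 =
    2 * (enorm x * enorm y) * (enorm x * enorm y - inner x y) by ring.
by rewrite pmulr_rge0 ?subr_ge0// mulr_gt0.
Qed.

Lemma enormD x y : enorm (x + y) <= enorm x + enorm y.
Proof.
rewrite -ler_sqr ?nnegrE ?addr_ge0 ?enorm_ge0// enormD_sqr.
by have := cauchy_schwarz x y; lra.
Qed.

Lemma enorm_le_sub x y : enorm x <= enorm y + enorm (x - y).
Proof. by rewrite -{1}(subrK y x) addrC enormD. Qed.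

End euclidean.

(** * Gaussian vectors *)

Lemma measurable_profile (R : realType) (K e r S : R) :
  measurable_fun setT (profile K e r S).
Proof.
rewrite /profile; apply: measurable_fun_ifT.
- exact: measurable_fun_ler.
- by apply: measurable_funB => //; apply: measurable_funM => //; exact: measurable_funX.
apply: measurable_fun_ifT => //.
- exact: measurable_fun_ler.
- apply: measurable_funM => //; apply: measurable_funX; exact: measurable_funB.
Qed.

Section gaussian_noise.
Variables (R : realType) (d : nat) (s : R) (g : probability 'rV[R]_d R).
Hypothesis s0 : 0 < s.
Hypothesis gE : forall (i : 'I_d) (A : set R), measurable A ->
  g [set u : 'rV[R]_d | A (u ord0 i)] = normal_prob 0 s A.

Lemma ge0_integral_coord (i : 'I_d) (f : R -> \bar R) :
  measurable_fun setT f -> (forall x, 0 <= f x)%E ->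
  (\int[g]_u f (u ord0 i) = \int[normal_prob 0 s]_v f v)%E.
Proof.
move=> mf f0.
rewrite -(@ge0_integral_law _ _ _ (measurableTypeR R) _ g _ (measurable_coord i))//.
by apply: eq_measure_integral => B mB _; exact: gE.
Qed.

(** Peak of the standard normal density. *)
Definition ball_const : R := (Num.sqrt (2 * pi))^-1.

Lemma ball_const_gt0 : 0 < ball_const.
Proof. by rewrite invr_gt0 sqrtr_gt0 mulr_gt0 ?pi_gt0. Qed.

(** One coordinate suffices: it must fall in an interval of length 2 rho / |sg|, where the density
    is at most [ball_const / s]. The bound is uniform in [y]. *)
Lemma gaussian_small_ball (y : 'rV[R]_d) (sg rho : R) : (0 < d)%N ->
  sg != 0 -> 0 < rho ->
  (g [set u : 'rV[R]_d | (`|y + sg *: u| <= rho)%R]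
   <= (2 * rho * ball_const / (`|sg| * s))%:E)%E.
Proof.
move=> d0 sg0 rho0; pose i := Ordinal d0.
have asg : 0 < `|sg| by rewrite normr_gt0.
pose a := - (y ord0 i) / sg; pose h := rho / `|sg|.
have h0 : 0 < h by rewrite divr_gt0.
pose A : set R := `[a - h, a + h]%classic.
apply: (@le_trans _ _ (g [set u : 'rV[R]_d | A (u ord0 i)])).
  apply: le_measure; rewrite ?inE.
  - rewrite -[X in measurable X]setTI.
    rewrite (_ : [set u | _] = (fun u => `|y + sg *: u|) @^-1` `]-oo, rho]).
      apply: (measurableT_comp (@measurable_sup_norm R d)) => //.
      by apply: measurable_rVD => //; apply: measurable_rVZ.
    by apply/seteqP; split => u /=; rewrite in_itv.
  - by have := @measurable_coord R d i measurableT A (measurable_itv _); rewrite setTI.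
  - move=> u /= hu; rewrite /A/= in_itv/= -ler_distl.
    rewrite /h ler_pdivlMr// -normrM mulrBl /a divfK// opprK.
    have := le_trans (normr_coord_le _ i) hu; rewrite !mxE.
    by rewrite addrC mulrC.
have mA : measurable A by exact: measurable_itv.
rewrite gE//; apply: le_trans (normal_prob_le s0 mA) _.
rewrite lebesgue_measure_itv/= lte_fin ifT; last by lra.
rewrite -EFinB -EFinM lee_fin normal_peakE// -/ball_const /h.
by rewrite le_eqVlt; apply/orP; left; apply/eqP; field; rewrite !gt_eqF.
Qed.

(** Lower bound for the mass that N(0, s^2) gives to [s, 2s]. *)
Definition shell_const : R := expR (- 2) / Num.sqrt (2 * pi).

Lemma shell_const_gt0 : 0 < shell_const.
Proof. by rewrite divr_gt0 ?expR_gt0 ?sqrtr_gt0 ?mulr_gt0 ?pi_gt0. Qed.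

(** For a coordinate i attaining |y|, the sup norm of y + sg u is at least |y_i + sg u_i| and the
    profile is nonincreasing, so the problem is one-dimensional. The price 8e comes from the second
    moment bound; the gain is collected only for v in [s, 2s], where v^2 >= s^2 and |sg v| <=
    r/2. *)
Lemma profile_gaussian (K e r S sg : R) (y : 'rV[R]_d) : (0 < d)%N ->
  0 < K -> 0 < e -> 0 < r -> e * (S - r) = K * r -> `|sg| * s <= r / 4 ->
  (\int[g]_u (profile K e r S `|y + sg *: u|%R)%:E
     + ((K + e) * shell_const * (sg * s) ^+ 2 * (`|y| <= r / 2)%R%:R)%:E
   <= (profile K e r S `|y|%R + 8 * e * (sg * s) ^+ 2)%:E)%E.
Proof.
move=> d0 K0 e0 r0 hS sgs.
have [i yi] := normr_coord_attained y d0.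
have Ke0 : 0 <= K + e by rewrite addr_ge0 ?ltW.
have esg0 : 0 <= 2 * e * sg ^+ 2.
  by apply: mulr_ge0; [apply: mulr_ge0 => //; exact: ltW|exact: sqr_ge0].
set a := `|y|; pose F v := profile K e r S `|y ord0 i + sg * v|.
have a0 : 0 <= a by exact: normr_ge0.
have F0 v : 0 <= F v by exact: profile_ge0.
have mF : measurable_fun setT F.
  apply: (measurableT_comp (@measurable_profile R K e r S)).
  apply: (measurableT_comp (@normr_measurable R setT)) => //.
  by apply: measurable_funD => //; exact: measurable_funM.
pose I := (\int[normal_prob 0 s]_v (F v)%:E)%E.
have I0 : (0 <= I)%E by apply: integral_ge0 => v _; rewrite lee_fin.
have leI : (\int[g]_u (profile K e r S `|y + sg *: u|%R)%:E <= I)%E.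
  rewrite /I -(@ge0_integral_coord i (fun v => (F v)%:E)) //; last 1 first.
    exact/measurable_EFinP.
  apply: ge0_le_integral => //.
  - by move=> u _; rewrite lee_fin profile_ge0.
  - apply/measurable_EFinP; apply: (measurableT_comp (@measurable_profile R K e r S)).
    apply: (measurableT_comp (@measurable_sup_norm R d)) => //.
    by apply: measurable_rVD => //; apply: measurable_rVZ.
  - apply/measurable_EFinP; apply: (measurableT_comp mF); exact: (measurable_coord i).
  - move=> u _; rewrite lee_fin; apply: profile_nonincreasing => //.
    by have := normr_coord_le (y + sg *: u) i; rewrite !mxE.
have leII : (I + I + (2 * ((K + e) * shell_const * (sg * s) ^+ 2 * (a <= r / 2)%R%:R))%:E
    <= (2 * (profile K e r S a + 8 * e * (sg * s) ^+ 2))%:E)%E.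
  (* By symmetry I + I integrates F(v) + F(-v), to which the second difference bound applies. *)
  have I' : (I = \int[normal_prob 0 s]_v (F (- v))%:E)%E.
    rewrite /I -(@ge0_integral_normal_opp R s s0 (fun v => (F v)%:E))//.
    exact/measurable_EFinP.
  pose G v := 2 * (K + e) * ((sg * v) ^+ 2 * ((a <= r / 2) && (`|sg * v| <= r / 2))%:R).
  have G0 v : 0 <= G v.
    by apply: mulr_ge0; apply: mulr_ge0 => //; exact: sqr_ge0.
  have mG : measurable_fun setT G.
    apply: measurable_funM; first exact: measurable_cst.
    apply: measurable_funM.
      by apply: measurable_funX; exact: mulrl_measurable.
    apply: (@measurableT_comp _ _ _ _ _ _ (fun b : bool => b%:R : R)) => //.
    case: (a <= r / 2) => //=.
    apply: measurable_fun_ler => //.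
    by apply: (measurableT_comp (@normr_measurable R setT)) => //; exact: measurable_funM.
  have mFN : measurable_fun setT (fun v : R => (F (- v))%:E).
    by apply/measurable_EFinP; apply: (measurableT_comp mF).
  have mF' : measurable_fun setT (fun v : R => (F v)%:E) by exact/measurable_EFinP.
  have mG' : measurable_fun setT (fun v : R => (G v)%:E) by exact/measurable_EFinP.
  have GI : ((2 * ((K + e) * shell_const * (sg * s) ^+ 2 * (a <= r / 2)%R%:R))%:E <=
      \int[normal_prob 0 s]_v (G v)%:E)%E.
    apply: (@le_trans _ _ (\int[normal_prob 0 s]_(v in `[s, (2 * s)%R])
        (2 * (K + e) * ((sg * s) ^+ 2 * (a <= r / 2)%R%:R))%:E)%E).
      rewrite integral_cst//=.
      have := normal_prob_shell_ge s0; rewrite -/shell_const => hsh.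
      have -> : 2 * ((K + e) * shell_const * (sg * s) ^+ 2 * (a <= r / 2)%R%:R) =
        2 * (K + e) * ((sg * s) ^+ 2 * (a <= r / 2)%R%:R) * shell_const by ring.
      rewrite EFinM; apply: lee_wpmul2l => //.
      by rewrite lee_fin; apply: mulr_ge0; apply: mulr_ge0 => //; exact: sqr_ge0.
    apply: (@le_trans _ _ (\int[normal_prob 0 s]_(v in `[s, (2 * s)%R]) (G v)%:E)%E).
      apply: ge0_le_integral => //.
      - by move=> v _; rewrite lee_fin; apply: mulr_ge0; apply: mulr_ge0 => //; exact: sqr_ge0.
      - exact: measurable_funTS.
      - move=> v /=; rewrite in_itv/= => /andP[sv v2s].
        have v0 : 0 < v by exact: lt_le_trans sv.
        have svr : `|sg * v| <= r / 2.
          rewrite normrM (gtr0_norm v0).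
          apply: (@le_trans _ _ (`|sg| * (2 * s))); first exact: ler_wpM2l.
          by lra.
        rewrite lee_fin /G svr andbT; apply: ler_wpM2l.
          by rewrite mulr_ge0.
        apply: ler_wpM2r => //.
        rewrite -(real_normK (num_real (sg * s))) -(real_normK (num_real (sg * v))).
        rewrite ler_sqr ?nnegrE// !normrM ler_wpM2l// !gtr0_norm//.
    by apply: ge0_subset_integral => // v _; rewrite lee_fin.
  apply: (@le_trans _ _ (I + I + \int[normal_prob 0 s]_v (G v)%:E)%E); first exact: leeD2l.
  rewrite {2}I' /I -ge0_integralD//; last 2 first.
    by move=> v _; rewrite lee_fin.
    by move=> v _; rewrite lee_fin.
  rewrite -ge0_integralD//; last 3 first.
    by move=> v _; rewrite -EFinD lee_fin addr_ge0.
    exact: emeasurable_funD.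
    by move=> v _; rewrite lee_fin.
  have mv2 : measurable_fun setT (fun v : R => (v ^+ 2)%:E).
    by apply/measurable_EFinP; exact: measurable_funX.
  apply: (@le_trans _ _ (\int[normal_prob 0 s]_v ((2 * profile K e r S a)%:E +
      (2 * e * sg ^+ 2)%:E * (v ^+ 2)%:E))%E).
    apply: ge0_le_integral => //.
    - by move=> v _; rewrite -!EFinD lee_fin !addr_ge0.
    - by do 2 apply: emeasurable_funD => //.
    - by apply: emeasurable_funD => //; exact: measurable_funeM.
    - move=> v _; rewrite -EFinM -!EFinD lee_fin.
      have := @profile_second_difference R K e r S K0 e0 r0 hS a (sg * v) a0.
      (* If y_i is negative, replacing it by a = |y_i| exchanges the two terms. *)
      have FF : F v + F (- v) =
          profile K e r S `|a + sg * v| + profile K e r S `|a - sg * v|.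
        rewrite /F /a yi mulrN.
        have [yi0|yi0] := leP 0 (y ord0 i); first by rewrite (ger0_norm yi0).
        rewrite (ltr0_norm yi0) addrC -(normrN (- y ord0 i + _)).
        by rewrite -(normrN (- y ord0 i - _)) !opprD !opprK.
      by rewrite FF /G exprMn; lra.
  rewrite ge0_integralD//; last 3 first.
    by move=> v _; rewrite lee_fin; apply: mulr_ge0 => //; exact: profile_ge0.
    by move=> v _; rewrite -EFinM lee_fin mulr_ge0 ?sqr_ge0.
    exact: measurable_funeM.
  have cstI (k : R) : (\int[normal_prob 0 s]_v k%:E = k%:E)%E.
    rewrite integral_cst// -[RHS]mule1; congr (_ * _)%E.
    exact: (integral_normal_pdf 0 s).
  rewrite cstI ge0_integralZl//; last 1 first.
    by move=> v _; rewrite lee_fin sqr_ge0.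
  rewrite mulrDr EFinD; apply: leeD2l.
  apply: (@le_trans _ _ ((2 * e * sg ^+ 2)%:E * (8 * s ^+ 2)%:E)%E).
    apply: lee_wpmul2l; last exact: normal_second_moment_le.
    by rewrite lee_fin.
  by rewrite -EFinM lee_fin exprMn; lra.
apply: le_trans (leeD2r _ leI) _.
by move: leII I0; move: (I) => [J||]//=; rewrite ?lee_fin -?EFinD ?lee_fin => h1 h2; lra.
Qed.

End gaussian_noise.

(** * The weight *)

Lemma profile_eq0 (R : realType) (K e r S a : R) : r < S -> S <= a ->
  profile K e r S a = 0.
Proof.
move=> rS Sa; rewrite /profile (lt_geF (lt_le_trans rS Sa)).
case: ifPn => // aS; have -> : a = S by apply/eqP; rewrite eq_le aS.
by rewrite subrr expr0n mulr0.
Qed.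

(** What a weight supported in the ball of radius [S] requires of the drift: points of a bounded
    region move by O(delta), and points farther away are not thrown inside the support. *)
Definition confined (R : realType) (d : nat) (step : R -> 'rV[R]_d -> 'rV[R]_d) :=
  forall S : R, 0 < S -> exists C S2 delta0 : R,
    [/\ 0 < C, S <= S2, 0 < delta0 &
     forall delta, 0 < delta -> delta <= delta0 -> forall x,
      (`|x| <= S2 -> `|step delta x - x| <= C * delta) /\
      (S2 < `|x| -> S <= `|step delta x|)].

Definition inside (R : realType) (d : nat) (rho : R) (x : 'rV[R]_d) : R :=
  (`|x| <= rho)%R%:R.

Definition weight_for (R : realType) (d : nat) (step : 'rV[R]_d -> 'rV[R]_d)
    (g : probability 'rV[R]_d R) (c K0 R0 delta sg : R) (V : 'rV[R]_d -> R) :=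
  [/\ measurable_fun setT V, forall x, 1 <= V x <= 2 &
    forall x, ((1 - c * delta + K0 * delta * inside R0 x)%:E
        * \int[g]_u (V (step x + sg *: u))%:E
      <= ((1 - c / 2 * delta) * V x)%:E)%E].

Lemma inside_ge0 (R : realType) (d : nat) (rho : R) (x : 'rV[R]_d) :
  0 <= inside rho x.
Proof. exact: ler0n. Qed.

Lemma measurable_inside (R : realType) (d : nat) (rho : R) :
  measurable_fun setT (@inside R d rho).
Proof.
apply: (@measurableT_comp _ _ _ _ _ _ (fun b : bool => b%:R : R)) => //.
by apply: measurable_fun_ler => //; exact: measurable_sup_norm.
Qed.

Section weight.
Variables (R : realType) (d : nat) (step : 'rV[R]_d -> 'rV[R]_d).
Variables (g : probability 'rV[R]_d R) (c K0 R0 delta sg : R).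
Hypotheses (d0 : (0 < d)%N) (c0 : 0 < c) (K00 : 0 < K0) (R00 : 0 < R0)
  (delta0 : 0 < delta) (sg0 : sg != 0) (small : 2 * (K0 + c) * delta <= 1).
Hypothesis gE : forall (i : 'I_d) (A : set R), measurable A ->
  g [set u : 'rV[R]_d | A (u ord0 i)] = normal_prob 0 (Num.sqrt delta) A.

Let s0 : 0 < Num.sqrt delta. Proof. by rewrite sqrtr_gt0. Qed.

Let cdelta : c * delta <= 1.
Proof.
have : 0 < K0 * delta by rewrite mulr_gt0.
by have := mulr_gt0 c0 delta0; have := small; lra.
Qed.

Let measurable_move (f : 'rV[R]_d -> R) (y : 'rV[R]_d) :
  measurable_fun setT f -> measurable_fun setT (fun u : 'rV[R]_d => (f (y + sg *: u))%:E).
Proof.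
move=> mf; apply/measurable_EFinP; apply: (measurableT_comp mf).
by apply: measurable_rVD => //; apply: measurable_rVZ.
Qed.

(* When a single noise increment already has standard deviation of order R0 or
   more, it leaves the ball with high probability, whatever the drift. *)
Lemma weight_large_increment :
  8 * (K0 + c) * R0 * ball_const R / c <= `|sg| * Num.sqrt delta ->
  weight_for step g c K0 R0 delta sg
    (fun x => 1 + 2 * (K0 + c) * delta * inside R0 x).
Proof.
move=> hm; have Kc0 : 0 < K0 + c by rewrite addr_gt0.
have bc0 := ball_const_gt0 R.
have asg : 0 < `|sg| * Num.sqrt delta by rewrite mulr_gt0 ?normr_gt0.
have Kd0 : 0 < 2 * (K0 + c) * delta by rewrite !mulr_gt0.
have mB := @measurable_inside R d R0.
split.
- by apply: measurable_funD => //; exact: measurable_funM.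
- move=> x; have := small; rewrite /inside.
  by case: (`|x| <= R0) => /= h; apply/andP; split; lra.
move=> x; set y := step x.
(* The factor 8 in [hm] makes 2(K0 + c) delta times the small-ball probability at most c delta /
   2. *)
have leI : (\int[g]_u (1 + 2 * (K0 + c) * delta * inside R0 (y + sg *: u))%:E <=
    (1 + c / 2 * delta)%:E)%E.
  under eq_integral do rewrite EFinD EFinM.
  rewrite ge0_integralD//; last 2 first.
    - by move=> u _; rewrite -EFinM lee_fin mulr_ge0 ?(ltW Kd0)// inside_ge0.
    - by apply: measurable_funeM; exact: measurable_move.
  rewrite integral_cst_probability EFinD; apply: leeD2l.
  rewrite ge0_integralZl//; last 3 first.
    - exact: measurable_move.
    - by move=> u _; rewrite lee_fin inside_ge0.
    - by rewrite lee_fin ltW.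
  have -> : (\int[g]_u (inside R0 (y + sg *: u))%:E =
      g [set u : 'rV[R]_d | (`|y + sg *: u| <= R0)%R])%E.
    rewrite -[X in _ = g X]setIT -integral_indic//; last first.
      rewrite -[X in measurable X]setTI.
      rewrite (_ : [set u | _] = (fun u => `|y + sg *: u|) @^-1` `]-oo, R0]).
        apply: (measurableT_comp (@measurable_sup_norm R d)) => //.
        by apply: measurable_rVD => //; apply: measurable_rVZ.
      by apply/seteqP; split => u /=; rewrite in_itv.
    by apply: eq_integral => u _; rewrite /inside indicE mem_setE.
  apply: (@le_trans _ _ ((2 * (K0 + c) * delta)%:E *
      (2 * R0 * ball_const R / (`|sg| * Num.sqrt delta))%:E)%E).
    apply: lee_wpmul2l; first by rewrite lee_fin ltW.
    exact: gaussian_small_ball.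
  rewrite -EFinM lee_fin.
  have -> : 2 * (K0 + c) * delta *
      (2 * R0 * ball_const R / (`|sg| * Num.sqrt delta)) =
      4 * (K0 + c) * R0 * ball_const R / (`|sg| * Num.sqrt delta) * delta by ring.
  rewrite ler_pM2r// ler_pdivrMr//.
  move: hm; rewrite ler_pdivrMr//; lra.
have q0 : 0 <= 1 - c * delta + K0 * delta * inside R0 x.
  apply: addr_ge0; first by rewrite subr_ge0.
  by apply: mulr_ge0; [rewrite mulr_ge0 ?ltW|exact: inside_ge0].
apply: le_trans (lee_wpmul2l _ leI) _; first by rewrite lee_fin.
rewrite -EFinM lee_fin /inside.
have cd0 : 0 < c * delta by rewrite mulr_gt0.
have Kd : 0 < K0 * delta by rewrite mulr_gt0.
have cc : 0 <= (c * delta) ^+ 2 by exact: sqr_ge0.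
have Kcd : 0 <= (1 - 2 * (K0 + c) * delta) * (c * delta).
  by rewrite mulr_ge0 ?subr_ge0// ltW.
have Kccd : 0 <= K0 * delta * (c * delta) by apply: mulr_ge0; exact: ltW.
(* First-order coefficients in delta: K0 - c/2 against 2 K0 + 3c/2 in the ball, -c/2 on both sides
   outside it. Squares are controlled by [small] or have the right sign. *)
case: (`|x| <= R0); rewrite /= ?mulr0 ?mulr1 ?addr0; lra.
Qed.

(** Budget per step, after division by sg^2: the convex part of the profile costs 8 e delta = c
    delta / 4, the drift at most c delta / 4 since its displacement C delta meets slope 2 Kb r, and
    the concave part returns Kb * shell_const * delta = (2 K0 + 2 c) delta. The gain is available
    from all of the ball of radius [R0], as one drift step moves by at most 1 and R0 + 1 <= r/2. *)
Lemma weight_small_increment (Kb e r S S2 C : R) :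
  0 < Kb -> 0 < e -> 0 < r -> 0 < C -> e * (S - r) = Kb * r -> 32 * e = c ->
  Kb * shell_const R = 2 * K0 + 2 * c ->
  `|sg| * Num.sqrt delta <= r / 4 -> R0 + 1 <= r / 2 ->
  profile_top Kb e r S <= sg ^+ 2 -> 8 * Kb * r * C <= c * sg ^+ 2 ->
  C * delta <= 1 -> S <= S2 ->
  (forall x, `|x| <= S2 -> `|step x - x| <= C * delta) ->
  (forall x, S2 < `|x| -> S <= `|step x|) ->
  weight_for step g c K0 R0 delta sg
    (fun x => 1 + (sg ^+ 2)^-1 * profile Kb e r S `|x|).
Proof.
move=> Kb0 e0 r0 C0 hS ec Kbk sgr Rr top_sg lip_sg Cd SS2 near far.
have sg2 : 0 < sg ^+ 2 by rewrite exprn_even_gt0.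
have isg0 : 0 <= (sg ^+ 2)^-1 by rewrite invr_ge0 ltW.
have rS := profile_rS Kb0 e0 r0 hS.
have mpr : measurable_fun setT (fun x : 'rV[R]_d => profile Kb e r S `|x|).
  exact: (measurableT_comp (@measurable_profile R Kb e r S) (@measurable_sup_norm R d)).
have pr0 (x : 'rV[R]_d) : 0 <= profile Kb e r S `|x| by exact: profile_ge0.
have V12 (x : 'rV[R]_d) : 1 <= 1 + (sg ^+ 2)^-1 * profile Kb e r S `|x| <= 2.
  apply/andP; split; first by rewrite lerDl (mulr_ge0 isg0 (pr0 x)).
  have : (sg ^+ 2)^-1 * profile Kb e r S `|x| <= 1.
    rewrite ler_pdivrMl// mulr1.
    exact: le_trans (profile_le_top Kb0 e0 r0 hS (normr_ge0 x)) top_sg.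
  lra.
split => //.
  by apply: measurable_funD => //; exact: measurable_funM.
move=> x; set y := step x.
have ss : (sg * Num.sqrt delta) ^+ 2 = sg ^+ 2 * delta.
  by rewrite exprMn sqr_sqrtr// ltW.
have kap0 := shell_const_gt0 R.
(* Far points land beyond [S], where the profile vanishes; near points are handled by the Lipschitz
   bound. *)
have drift : profile Kb e r S `|y| <= profile Kb e r S `|x| + c / 4 * (sg ^+ 2 * delta).
  have [xS|xS] := leP `|x| S2; last first.
    rewrite (profile_eq0 _ _ rS (far _ xS)); apply: addr_ge0 => //.
    by apply: mulr_ge0; apply: ltW; [exact: divr_gt0|exact: mulr_gt0].
  apply: le_trans (profile_lipschitz Kb0 e0 r0 hS (normr_ge0 y) (normr_ge0 x)) _.
  rewrite lerD2l; have Kr : 0 <= 2 * Kb * r by apply: ltW; rewrite !mulr_gt0.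
  apply: (@le_trans _ _ (2 * Kb * r * (C * delta))).
    by apply: ler_wpM2l => //; apply: le_trans (ler_dist_dist _ _) (near _ xS).
  have : 0 <= (c * sg ^+ 2 - 8 * Kb * r * C) * delta.
    by apply: mulr_ge0; [rewrite subr_ge0|exact: ltW].
  lra.
have in_y : inside R0 x <= (`|y| <= r / 2)%R%:R.
  rewrite /inside; have [xR|//] := leP `|x| R0.
  have xS : `|x| <= S2.
    by apply: le_trans SS2; apply: le_trans (ltW rS); lra.
  have /le_trans/(_ Cd) yx := near _ xS.
  have : `|y| <= `|y - x| + `|x| by rewrite -{1}(subrK x y) ler_normD.
  move=> h; have -> // : `|y| <= r / 2 by rewrite -/y in yx; lra.
have := @profile_gaussian R d (Num.sqrt delta) g s0 gE Kb e r S sg y d0 Kb0 e0 r0 hS sgr.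
set I := (\int[g]_u (profile Kb e r S `|y + sg *: u|)%:E)%E => hI.
have I0 : (0 <= I)%E by apply: integral_ge0 => u _; rewrite lee_fin.
have -> : (\int[g]_u (1 + (sg ^+ 2)^-1 * profile Kb e r S `|y + sg *: u|)%:E =
    1 + ((sg ^+ 2)^-1)%:E * I)%E.
  under eq_integral do rewrite EFinD EFinM.
  rewrite ge0_integralD//; last 2 first.
    - by move=> u _; rewrite -EFinM lee_fin (mulr_ge0 isg0 (pr0 _)).
    - by apply: measurable_funeM; exact: (measurable_move y mpr).
  rewrite integral_cst_probability ge0_integralZl//.
  - exact: (measurable_move y mpr).
  - by move=> u _; rewrite lee_fin.
move: hI I0; move: (I) => [J||]//=; rewrite -!EFinM -?EFinD ?lee_fin => hJ J0.
have vx : 1 <= 1 + (sg ^+ 2)^-1 * profile Kb e r S `|x| <= 2 by exact: V12.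
set V := 1 + (sg ^+ 2)^-1 * profile Kb e r S `|x| in vx *.
pose i := inside R0 x; rewrite -/i in in_y *.
have Vsg : sg ^+ 2 * V = sg ^+ 2 + profile Kb e r S `|x|.
  by rewrite /V mulrDr mulr1 mulVKf// gt_eqF.
have JV : 1 + (sg ^+ 2)^-1 * J <= V + c / 2 * delta - (2 * K0 + 2 * c) * delta * i.
  rewrite -(ler_pM2l sg2) mulrDr mulr1 mulVKf ?gt_eqF// mulrBr mulrDr Vsg.
  move: hJ; rewrite ss => hJ.
  have Kek : 0 <= (Kb + e) * shell_const R * (sg ^+ 2 * delta).
    by apply: ltW; apply: mulr_gt0; apply: mulr_gt0 => //; exact: addr_gt0.
  have h1 := ler_wpM2l Kek in_y.
  have h2 : 0 <= e * shell_const R * (sg ^+ 2 * delta) * i.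
    apply: mulr_ge0; last exact: inside_ge0.
    by apply: ltW; apply: mulr_gt0; exact: mulr_gt0.
  have h3 : Kb * shell_const R * (sg ^+ 2 * delta) * i =
    (2 * K0 + 2 * c) * (sg ^+ 2 * delta) * i by rewrite Kbk.
  have h4 : 32 * e * (sg ^+ 2 * delta) = c * (sg ^+ 2 * delta) by rewrite ec.
  lra.
set PV := 1 + (sg ^+ 2)^-1 * J in JV *.
have PV1 : 1 <= PV by rewrite /PV lerDl (mulr_ge0 isg0).
move/andP: vx => [V1 V2].
have cd0 : 0 < c * delta by rewrite mulr_gt0.
have Kd : 0 < K0 * delta by rewrite mulr_gt0.
have cc : 0 <= (c * delta) ^+ 2 by exact: sqr_ge0.
have cdV : 0 <= c * delta * (V - 1) by apply: mulr_ge0; [exact: ltW|rewrite subr_ge0].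
have cdV2 : 0 <= c * delta * (2 - V) by apply: mulr_ge0; [exact: ltW|rewrite subr_ge0].
rewrite /i /inside in JV *.
(* In the ball V <= 2 bounds K0 delta V by 2 K0 delta, which the gain covers; outside, V >= 1 lets
   half of c delta V pay for c delta / 2. *)
case: (`|x| <= R0) JV; rewrite ?mulr0 ?mulr1 ?addr0 ?subr0 => JV.
  have KdV : 0 <= K0 * delta * (2 - V) by apply: mulr_ge0; [exact: ltW|rewrite subr_ge0].
  have Kccd : 0 <= K0 * delta * (c * delta) by apply: mulr_ge0; exact: ltW.
  have KK : 0 <= (K0 * delta) ^+ 2 by exact: sqr_ge0.
  have Kd1 : 0 <= 1 + K0 * delta by lra.
  have h1 := ler_wpM2l Kd1 JV.
  have h2 : 0 <= c * delta * PV by apply: mulr_ge0; lra.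
  lra.
have cd1 : 0 <= 1 - c * delta by rewrite subr_ge0.
have h1 := ler_wpM2l cd1 JV.
lra.
Qed.

End weight.

Lemma weight_exists (R : realType) (d : nat) (step : R -> 'rV[R]_d -> 'rV[R]_d)
    (c K0 R0 : R) : (0 < d)%N -> 0 < c -> 0 < K0 -> 0 < R0 -> confined step ->
  exists sigma0 delta1 : R, [/\ 0 < sigma0, 0 < delta1 &
    forall delta sg (g : probability 'rV[R]_d R), 0 < delta -> delta <= delta1 ->
      sigma0 <= `|sg| ->
      (forall (i : 'I_d) (A : set R), measurable A ->
         g [set u : 'rV[R]_d | A (u ord0 i)] = normal_prob 0 (Num.sqrt delta) A) ->
      exists V, weight_for (step delta) g c K0 R0 delta sg V].
Proof.
move=> d0 c0 K00 R00 conf.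
have bc0 := ball_const_gt0 R; have kap0 := shell_const_gt0 R.
have Kc0 : 0 < K0 + c by rewrite addr_gt0.
(* Threshold for the standard deviation |sg| sqrt delta that separates the two regimes. *)
pose m := 8 * (K0 + c) * R0 * ball_const R / c.
have m0 : 0 < m by rewrite divr_gt0// !mulr_gt0.
(* At least 4m, so that increments below the threshold satisfy |sg| sqrt delta <= r/4, and at least
   2(R0 + 1). *)
pose r := 4 * m + 2 * R0 + 2.
have r0 : 0 < r by rewrite /r; lra.
pose Kb := (2 * K0 + 2 * c) / shell_const R.
have Kb0 : 0 < Kb by rewrite divr_gt0//; lra.
pose e := c / 32; have e0 : 0 < e by rewrite divr_gt0.
pose S := r + Kb * r / e.
have S0 : 0 < S by rewrite addr_gt0// divr_gt0// mulr_gt0.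
have hS : e * (S - r) = Kb * r by rewrite /S addrAC subrr add0r mulrCA mulfV ?mulr1// gt_eqF.
have [C [S2 [dl [C0 SS2 dl0 near]]]] := conf S S0.
have T0 : 0 <= profile_top Kb e r S.
  by apply: addr_ge0; apply: mulr_ge0; [exact: ltW|exact: sqr_ge0|exact: ltW|exact: sqr_ge0].
pose T := 8 * Kb * r * C / c.
have T'0 : 0 < T.
  by apply: divr_gt0 => //; do 3 apply: mulr_gt0 => //.
(* The summand 1 gives |sg| <= sg^2; the other two make sg^2 dominate the height of the profile and
   the drift cost. *)
exists (1 + profile_top Kb e r S + T),
  (Num.min dl (Num.min C^-1 (2 * (K0 + c))^-1)).
split; first by lra.
  by rewrite !lt_min dl0 !invr_gt0 C0 mulr_gt0.
move=> delta sg g delta0; rewrite !le_min => /and3P[dl1 dl2 dl3] sgs gE.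
have sg1 : 1 <= `|sg| by lra.
have sg0 : sg != 0 by rewrite -normr_gt0; lra.
have small : 2 * (K0 + c) * delta <= 1.
  by rewrite mulrC -ler_pdivlMr ?mul1r// mulr_gt0.
have Cd : C * delta <= 1 by rewrite mulrC -ler_pdivlMr ?mul1r.
have sg2 : `|sg| <= sg ^+ 2.
  by rewrite -real_normK ?num_real// expr2 ler_peMl.
have [hm|hm] := leP m (`|sg| * Num.sqrt delta).
  exists (fun x => 1 + 2 * (K0 + c) * delta * inside R0 x).
  exact: weight_large_increment.
exists (fun x => 1 + (sg ^+ 2)^-1 * profile Kb e r S `|x|).
apply: (weight_small_increment d0 c0 K00 delta0 sg0 small gE
  (Kb := Kb) (e := e) (r := r) (S := S) (S2 := S2) (C := C)) => //.
- by rewrite /e mulrCA mulfV ?mulr1.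
- by rewrite /Kb divfK// gt_eqF.
- by rewrite /r; lra.
- by rewrite /r; lra.
- lra.
- by rewrite [leRHS]mulrC -ler_pdivrMr// -/T; lra.
- by move=> x; have [] := near _ delta0 dl1 x.
- by move=> x; have [] := near _ delta0 dl1 x.
Qed.

(** * Synchronous coupling *)

Section transition.
Variables (R : realType) (d : nat) (step : 'rV[R]_d -> 'rV[R]_d) (sg : R).
Variable g : probability 'rV[R]_d R.
Hypothesis mstep : measurable_fun setT step.

Lemma measurable_move : measurable_fun setT
  (fun w : 'rV[R]_d * 'rV[R]_d => step w.1 + sg *: w.2).
Proof.
apply: measurable_rVD; first exact: measurableT_comp mstep measurable_fst.
by apply: measurable_rVZ => //; exact: measurable_snd.
Qed.

Lemma measurable_sync_move : measurable_fun setT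
  (fun w : ('rV[R]_d * 'rV[R]_d) * 'rV[R]_d =>
     (step w.1.1 + sg *: w.2, step w.1.2 + sg *: w.2)).
Proof.
have m1 : measurable_fun setT (fun w : ('rV[R]_d * 'rV[R]_d) * 'rV[R]_d => w.1.1).
  exact: measurableT_comp measurable_fst measurable_fst.
have m2 : measurable_fun setT (fun w : ('rV[R]_d * 'rV[R]_d) * 'rV[R]_d => w.1.2).
  exact: measurableT_comp measurable_snd measurable_fst.
apply/measurable_fun_pair; apply: measurable_rVD.
- exact: measurableT_comp mstep m1.
- by apply: measurable_rVZ => //; exact: measurable_snd.
- exact: measurableT_comp mstep m2.
- by apply: measurable_rVZ => //; exact: measurable_snd.
Qed.

(** Law after n steps, built from the initial and increment laws only: the two schemes may live on
    different Brownian bases, and on this level they can be coupled. *)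
Fixpoint chain (mu : probability 'rV[R]_d R) (n : nat) : probability 'rV[R]_d R :=
  if n is m.+1 then law (chain mu m \x g)%E measurable_move else mu.

Fixpoint sync_chain (pi : probability ('rV[R]_d * 'rV[R]_d)%type R) (n : nat) :
    probability ('rV[R]_d * 'rV[R]_d)%type R :=
  if n is m.+1 then law (sync_chain pi m \x g)%E measurable_sync_move else pi.

(** Used with [p] equal to [fst] and [snd]: taking a marginal of the pair commutes with adjoining
    the independent increment. *)
Lemma law_fst_prod (pi : probability ('rV[R]_d * 'rV[R]_d)%type R)
    (mu : probability 'rV[R]_d R) (p : 'rV[R]_d * 'rV[R]_d -> 'rV[R]_d)
    (mp : measurable_fun setT p) :
  (forall A, measurable A -> pi (p @^-1` A) = mu A) ->
  forall B, measurable B ->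
    (pi \x g)%E [set w | B (p w.1, w.2)] = (mu \x g)%E B.
Proof.
move=> hp B mB.
have mq : measurable_fun setT
    (fun w : ('rV[R]_d * 'rV[R]_d) * 'rV[R]_d => (p w.1, w.2)).
  apply/measurable_fun_pair; last exact: measurable_snd.
  exact: measurableT_comp mp measurable_fst.
symmetry; apply: (@product_measure_unique _ _ _ _ _ mu g (law (pi \x g)%E mq)) => //.
move=> A1 A2 mA1 mA2; rewrite /= lawE.
rewrite (_ : _ @^-1` _ = (p @^-1` A1) `*` A2)//.
have mpA : measurable (p @^-1` A1) by rewrite -[X in measurable X]setTI; exact: mp.
by rewrite product_measure1E//; congr (_ * _)%E; exact: hp.
exact: measurable_id.
Qed.

Lemma sync_chain_coupling (mu nu : probability 'rV[R]_d R) pi n :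
  coupling mu nu pi -> coupling (chain mu n) (chain nu n) (sync_chain pi n).
Proof.
move=> h; elim: n => [//|n IH] A mA.
pose B : set ('rV[R]_d * 'rV[R]_d) := (fun w => step w.1 + sg *: w.2) @^-1` A.
have mB : measurable B by rewrite -[X in measurable X]setTI; exact: measurable_move.
split.
- transitivity ((sync_chain pi n \x g)%E [set w | B (w.1.1, w.2)]); last first.
    apply: (law_fst_prod measurable_fst _ mB) => A' mA'.
    have [<- _] := IH A' mA'; congr (sync_chain pi n _).
    by apply/seteqP; split => w //= [].
  congr ((sync_chain pi n \x g)%E _).
  by apply/seteqP; split => w //= [].
- transitivity ((sync_chain pi n \x g)%E [set w | B (w.1.2, w.2)]); last first.
    apply: (law_fst_prod measurable_snd _ mB) => A' mA'.
    have [_ <-] := IH A' mA'; congr (sync_chain pi n _).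
    by apply/seteqP; split => w //= [].
  congr ((sync_chain pi n \x g)%E _).
  by apply/seteqP; split => w //= [].
Qed.

Variables (q V : 'rV[R]_d -> R) (theta : R).
Hypothesis V_ge0 : forall x, 0 <= V x.
Hypothesis mV : measurable_fun setT V.
Hypothesis theta_ge0 : 0 <= theta.
Hypothesis step_q : forall x y,
  enorm (step x - step y) ^+ 2 <= q x * enorm (x - y) ^+ 2.
Hypothesis qV : forall x, ((q x)%:E * \int[g]_u (V (step x + sg *: u))%:E
  <= (theta * V x)%:E)%E.

Let cost (z : 'rV[R]_d * 'rV[R]_d) : \bar R :=
  (V z.1 * enorm (z.1 - z.2) ^+ 2)%:E.

Let cost_ge0 z : (0 <= cost z)%E.
Proof. by rewrite lee_fin mulr_ge0 ?sqr_ge0. Qed.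

Lemma measurable_sqr_dist : measurable_fun setT
  (fun z : 'rV[R]_d * 'rV[R]_d => enorm (z.1 - z.2) ^+ 2).
Proof.
apply: measurable_funX; apply: (measurableT_comp (@measurable_enorm R d)).
by apply: measurable_rVB; [exact: measurable_fst|exact: measurable_snd].
Qed.

Let measurable_cost : measurable_fun setT cost.
Proof.
apply/measurable_EFinP/measurable_funM; last exact: measurable_sqr_dist.
exact: measurableT_comp mV measurable_fst.
Qed.

(** By Tonelli the increment is integrated first. It cancels in the difference, so the squared
    distance is a constant factor of the inner integral and [step_q] and [qV] combine. *)
Lemma sync_cost_step (pi : probability ('rV[R]_d * 'rV[R]_d)%type R) :
  (\int[law (pi \x g)%E measurable_sync_move]_z cost z
   <= theta%:E * \int[pi]_z cost z)%E.
Proof.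
rewrite ge0_integral_law// fubini_tonelli1//=; last first.
  exact: measurableT_comp measurable_cost measurable_sync_move.
rewrite -ge0_integralZl//.
apply: ge0_le_integral => //.
- by move=> z _; apply: integral_ge0.
- apply: (@measurable_fun_fubini_tonelli_F _ _ _ _ _ g
    (fun w => cost (step w.1.1 + sg *: w.2, step w.1.2 + sg *: w.2))) => //.
  exact: measurableT_comp measurable_cost measurable_sync_move.
- exact: measurable_funeM.
move=> [x y] _; rewrite /fubini_F /cost/=.
have mVm : measurable_fun setT (fun u : 'rV[R]_d => (V (step x + sg *: u))%:E).
  apply/measurable_EFinP; apply: (measurableT_comp mV).
  by apply: measurable_rVD => //; apply: measurable_rVZ.
have D0 : 0 <= enorm (step x - step y) ^+ 2 by exact: sqr_ge0.
rewrite (eq_integral (fun u : 'rV[R]_d => (enorm (step x - step y) ^+ 2)%:E *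
    (V (step x + sg *: u))%:E)%E); last first.
  move=> u _; rewrite -EFinM mulrC.
  by rewrite (_ : _ - _ = step x - step y)// opprD addrACA subrr addr0.
rewrite ge0_integralZl//; last by move=> u _; rewrite lee_fin.
have I0 : (0 <= \int[g]_u (V (step x + sg *: u))%:E)%E.
  by apply: integral_ge0 => u _; rewrite lee_fin.
apply: (@le_trans _ _ ((enorm (x - y) ^+ 2)%:E *
    ((q x)%:E * \int[g]_u (V (step x + sg *: u))%:E))%E).
  by rewrite muleA -EFinM; apply: lee_wpmul2r => //; rewrite lee_fin mulrC.
apply: (@le_trans _ _ ((enorm (x - y) ^+ 2)%:E * (theta * V x)%:E)%E).
  by apply: lee_wpmul2l => //; rewrite lee_fin sqr_ge0.
by rewrite -!EFinM lee_fin [leLHS]mulrC -mulrA.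
Qed.

Lemma sync_cost (pi : probability ('rV[R]_d * 'rV[R]_d)%type R) n :
  (\int[sync_chain pi n]_z cost z <= (theta ^+ n)%:E * \int[pi]_z cost z)%E.
Proof.
elim: n => [|n IH]; first by rewrite expr0 mul1e.
apply: le_trans (sync_cost_step _) _.
by rewrite exprS EFinM -muleA; apply: lee_wpmul2l.
Qed.

End transition.

(** Every coupling of the initial laws is evolved synchronously and serves as a competitor at step
    [n]. The plain cost lies below the weighted one, which is at most twice the plain cost: hence
    the 2 under the root. *)
Lemma W2_chain (R : realType) (d : nat) (step : 'rV[R]_d -> 'rV[R]_d) (sg : R)
    (g : probability 'rV[R]_d R) (mstep : measurable_fun setT step)
    (q V : 'rV[R]_d -> R) (theta : R) (mu nu : probability 'rV[R]_d R) n :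
  (forall x, 1 <= V x <= 2) ->
  measurable_fun setT V -> 0 < theta ->
  (forall x y, enorm (step x - step y) ^+ 2 <= q x * enorm (x - y) ^+ 2) ->
  (forall x, ((q x)%:E * \int[g]_u (V (step x + sg *: u))%:E
     <= (theta * V x)%:E)%E) ->
  (W2 (chain sg g mstep mu n) (chain sg g mstep nu n)
   <= (Num.sqrt (2 * theta ^+ n))%:E * W2 mu nu)%E.
Proof.
move=> V12 mV theta0 step_q qV.
have V0 x : 0 <= V x by have /andP[/(le_trans ler01)] := V12 x.
have th0 : 0 < 2 * theta ^+ n by rewrite mulr_gt0// exprn_gt0.
have mD := @measurable_sqr_dist R d.
have mD' : measurable_fun setT
    (fun z : 'rV[R]_d * 'rV[R]_d => (enorm (z.1 - z.2) ^+ 2)%:E).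
  exact/measurable_EFinP.
have mVD : measurable_fun setT
    (fun z : 'rV[R]_d * 'rV[R]_d => (V z.1 * enorm (z.1 - z.2) ^+ 2)%:E).
  apply/measurable_EFinP/measurable_funM => //.
  exact: measurableT_comp mV measurable_fst.
rewrite -lee_pdivrMl ?sqrtr_gt0//; apply: le_ereal_inf_tmp => _ [pi hpi <-].
rewrite lee_pdivrMl ?sqrtr_gt0//.
apply: ge_ereal_inf; eexists.
  by exists (sync_chain sg g mstep pi n) => //; exact: sync_chain_coupling.
set I := (\int[pi]_z _)%E.
have I0 : (0 <= I)%E by apply: integral_ge0 => z _; rewrite lee_fin sqr_ge0.
have -> : ((Num.sqrt (2 * theta ^+ n))%:E = (2 * theta ^+ n)%:E `^ 2^-1)%E.
  by rewrite poweR_EFin powR12_sqrt// ltW.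
rewrite -poweRM//; last by rewrite lee_fin ltW.
apply: gt0_ler_poweR; rewrite ?in_itv/= ?leey ?andbT//.
- by apply: integral_ge0 => z _; rewrite lee_fin sqr_ge0.
- by apply: mule_ge0 => //; rewrite lee_fin ltW.
apply: (@le_trans _ _ (\int[sync_chain sg g mstep pi n]_z
    (V z.1 * enorm (z.1 - z.2) ^+ 2)%:E)%E).
  apply: ge0_le_integral => //.
  - by move=> z _; rewrite lee_fin sqr_ge0.
  - move=> z _; rewrite lee_fin ler_peMl ?sqr_ge0//.
    by have /andP[] := V12 z.1.
apply: le_trans (sync_cost mstep V0 mV (ltW theta0) step_q qV pi n) _.
rewrite mulrC EFinM -muleA; apply: lee_wpmul2l.
  by rewrite lee_fin exprn_ge0 ?ltW.
rewrite /I -ge0_integralZl//; last by move=> z _; rewrite lee_fin sqr_ge0.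
apply: ge0_le_integral => //.
- by move=> z _; rewrite lee_fin mulr_ge0 ?sqr_ge0.
- exact: measurable_funeM.
- move=> z _; rewrite -EFinM lee_fin ler_wpM2r ?sqr_ge0//.
  by have /andP[] := V12 z.1.
Qed.

(** * The law of the scheme as a Markov chain *)

Lemma pair_law (R : realType) (d : nat) (disp : measure_display)
    (Omega : measurableType disp) (P : probability Omega R)
    (mu g : probability 'rV[R]_d R) (X xi : Omega -> 'rV[R]_d) :
  measurable_fun setT X -> measurable_fun setT xi ->
  (forall A, measurable A -> P (X @^-1` A) = mu A) ->
  (forall A, measurable A -> P (xi @^-1` A) = g A) ->
  (forall A B, measurable A -> measurable B ->
     P (X @^-1` A `&` xi @^-1` B) = (P (X @^-1` A) * P (xi @^-1` B))%E) ->
  forall B, measurable B -> P [set w | B (X w, xi w)] = (mu \x g)%E B.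
Proof.
move=> mX mxi hX hxi hind B mB.
have mp : measurable_fun setT (fun w => (X w, xi w)) by exact/measurable_fun_pair.
symmetry; apply: (@product_measure_unique _ _ _ _ _ mu g (law P mp)) => //.
move=> A1 A2 mA1 mA2.
transitivity (P (X @^-1` A1 `&` xi @^-1` A2)); first by congr (P _).
by rewrite hind// hX// hxi.
Qed.

Section filtered.
Context (R : realType) (d : nat) (disp : measure_display)
  (Omega : measurableType disp) (G : set (set Omega)).
Hypothesis sG : sigma_algebra setT G.

Lemma measurable_wrtP (X : Omega -> 'rV[R]_d) : measurable_wrt G X <->
  measurable_fun setT (X : g_sigma_algebraType G -> 'rV[R]_d).
Proof.
split=> [h _ B mB|h B mB].
  by rewrite setTI; apply: sub_sigma_algebra; exact: h.
by have := h measurableT B mB; rewrite setTI /measurable/= sigma_algebra_id.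
Qed.

End filtered.

Section scheme_chain.
Variables (R : realType) (d : nat) (step : 'rV[R]_d -> 'rV[R]_d) (sg delta : R).
Hypothesis mstep : measurable_fun setT step.
Hypothesis delta0 : 0 < delta.
Variables (B : brownian_basis R d) (X0 : bb_Omega B -> 'rV[R]_d).
Hypothesis mX0 : measurable_wrt (bb_F B 0) X0.

Let X := scheme step sg delta (bb_W B) X0.
Let dW (n : nat) (w : bb_Omega B) : 'rV[R]_d :=
  bb_W B (n.+1%:R * delta) w - bb_W B (n%:R * delta) w.

Let t0 n : 0 <= n%:R * delta. Proof. by rewrite mulr_ge0// ltW. Qed.
Let tS n : n%:R * delta < n.+1%:R * delta.
Proof. by rewrite ltr_pM2r// ltr_nat. Qed.

Let measurable_wrt_W n m : (m <= n)%N ->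
  measurable_wrt (bb_F B (n%:R * delta)) (bb_W B (m%:R * delta)).
Proof.
move=> mn A mA; have [_ _ mono _] := bb_filtration B.
apply: (mono (m%:R * delta)) => //; first by rewrite ler_pM2r// ler_nat.
by have [_ mW _ _ _] := bb_brownian B; exact: mW.
Qed.

Let sF n : sigma_algebra setT (bb_F B (n%:R * delta)).
Proof. by have [_ h _ _] := bb_filtration B; exact: (h _ (t0 n)).1. Qed.

Let measurable_wrt_dW n : measurable_wrt (bb_F B (n.+1%:R * delta)) (dW n).
Proof.
apply/(measurable_wrtP (sF n.+1)); apply: measurable_rVB;
by apply/(measurable_wrtP (sF n.+1)); exact: measurable_wrt_W.
Qed.

Lemma scheme_adapted n : measurable_wrt (bb_F B (n%:R * delta)) (X n).
Proof.
elim: n => [|n IH]; first by rewrite mul0r.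
have [_ _ mono _] := bb_filtration B.
apply/(measurable_wrtP (sF n.+1)); apply: measurable_rVD.
  apply: (measurableT_comp mstep); apply/(measurable_wrtP (sF n.+1)) => A mA.
  by apply: (mono (n%:R * delta)) => //; [exact: ltW|exact: IH].
apply: measurable_rVZ => //; apply/(measurable_wrtP (sF n.+1)).
exact: measurable_wrt_dW.
Qed.

Let measurable_of_wrt n (Y : bb_Omega B -> 'rV[R]_d) :
  measurable_wrt (bb_F B (n%:R * delta)) Y -> measurable_fun setT Y.
Proof.
move=> h _ A mA; rewrite setTI.
by have [_ sub _ _] := bb_filtration B; apply: (sub _ (t0 n)).2; exact: h.
Qed.

Lemma measurable_increment n : measurable_fun setT (dW n).
Proof. exact: measurable_of_wrt (measurable_wrt_dW n). Qed.

Lemma increment_gaussian n (a : 'I_d -> set R) : (forall i, measurable (a i)) ->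
  bb_P B (dW n @^-1` [set u : 'rV[R]_d | forall i, a i (u ord0 i)]) =
  (\prod_(i < d) normal_prob 0 (Num.sqrt delta) (a i))%E.
Proof.
move=> ma; have [_ _ _ gauss _] := bb_brownian B.
have dt : n.+1%:R * delta - n%:R * delta = delta.
  by rewrite -mulrBl -natrB ?leqnSn// subSnn mul1r.
by have := gauss _ _ (t0 n) (tS n) a ma; rewrite dt.
Qed.

(** X_n is measurable for the past at time n delta, the next increment is independent of it, so the
    pair has the product law used in [chain]. *)
Lemma scheme_chain (mu g : probability 'rV[R]_d R) n :
  (forall A, measurable A -> bb_P B (X0 @^-1` A) = mu A) ->
  (forall n A, measurable A -> bb_P B (dW n @^-1` A) = g A) ->
  forall A, measurable A -> bb_P B (X n @^-1` A) = chain sg g mstep mu n A.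
Proof.
move=> hmu hg; elim: n => [|n IH] A mA; first exact: hmu.
pose C : set ('rV[R]_d * 'rV[R]_d) := (fun w => step w.1 + sg *: w.2) @^-1` A.
have mC : measurable C.
  by rewrite -[X in measurable X]setTI; exact: measurable_move.
apply: (@pair_law R d _ _ (bb_P B) (chain sg g mstep mu n) g (X n) (dW n) _ _ _ _ _ C) => //.
- exact: measurable_of_wrt (scheme_adapted n).
- exact: measurable_increment.
- exact: hg.
- move=> A1 A2 mA1 mA2; have [_ _ ind _ _] := bb_brownian B.
  by apply: (ind _ _ (t0 n) (tS n)) => //; exact: scheme_adapted.
Qed.

End scheme_chain.

(** * From one-step bounds to contraction *)

Lemma W2_ge0 (R : realType) (d : nat) (mu nu : set 'rV[R]_d -> \bar R) :
  (0 <= W2 mu nu)%E.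
Proof. by apply: le_ereal_inf_tmp => _ [pi _ <-]; exact: poweR_ge0. Qed.

(** Needed since laws of the scheme are set functions on all sets, whereas the chain laws are known
    to agree with them on measurable sets; couplings test only the latter. *)
Lemma eq_W2 (R : realType) (d : nat) (mu mu' nu nu' : set 'rV[R]_d -> \bar R) :
  (forall A, measurable A -> mu A = mu' A) ->
  (forall A, measurable A -> nu A = nu' A) -> W2 mu nu = W2 mu' nu'.
Proof.
move=> hmu hnu; rewrite /W2; congr (ereal_inf _).
suff -> : coupling mu nu = coupling mu' nu' by [].
by apply/seteqP; split => pi hpi A mA; have [h1 h2] := hpi A mA;
  split; rewrite ?h1 ?h2 ?hmu ?hnu.
Qed.

(** The indicator involves [x] only, so that a weight depending on the first component can
    compensate it. *)
Definition contractive_outside_ball (R : realType) (d : nat)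
    (step : R -> 'rV[R]_d -> 'rV[R]_d) :=
  exists c K0 R0 delta0 : R, [/\ 0 < c, 0 < K0, 0 < R0, 0 < delta0 &
    forall delta, 0 < delta -> delta <= delta0 -> forall x y,
      enorm (step delta x - step delta y) ^+ 2 <=
      (1 - c * delta + K0 * delta * inside R0 x) * enorm (x - y) ^+ 2].

(** From 1 - u <= exp(-u) with u = c delta / 2; the root halves the exponent. *)
Lemma sqrt_geometric_le (R : realType) (c delta : R) (n : nat) :
  0 <= 1 - c / 2 * delta ->
  Num.sqrt (2 * (1 - c / 2 * delta) ^+ n) <=
  Num.sqrt 2 * expR (- (c / 4 * n%:R * delta)).
Proof.
move=> t0; rewrite sqrtrM// ler_wpM2l ?sqrtr_ge0//.
rewrite -(ger0_norm (expR_ge0 _)) -sqrtr_sqr ler_wsqrtr// -expRM_natl.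
have -> : 2 * - (c / 4 * n%:R * delta) = n%:R * - (c / 2 * delta) by field.
rewrite expRM_natl lerXn2r ?nnegrE ?expR_ge0//.
exact: expR_ge1Dx.
Qed.

Lemma prod_normal_prob_one (R : realType) (d : nat) (s : R) (i : 'I_d)
    (A : set R) :
  (\prod_(j < d) normal_prob 0 s (if j == i then A else setT) =
   normal_prob 0 s A)%E.
Proof.
rewrite (bigD1 i)//= eqxx big1 ?mule1// => j /negbTE ->.
exact: (integral_normal_pdf 0 s).
Qed.

Lemma W2_contraction_of_step (R : realType) (d : nat)
    (step : R -> 'rV[R]_d -> 'rV[R]_d) : (0 < d)%N ->
  (forall delta, 0 < delta -> delta <= 1 -> measurable_fun setT (step delta)) ->
  contractive_outside_ball step -> confined step -> W2_contraction step.
Proof.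
move=> d0 mstep [c [K0 [R0 [dl0 [c0 K00 R00 dl00 hstep]]]]] conf.
have [sigma0 [dl1 [sigma00 dl10 hV]]] := weight_exists d0 c0 K00 R00 conf.
exists (Num.sqrt 2), sigma0, (c / 4), (Num.min (Num.min 1 dl0) (Num.min dl1 c^-1)); split.
  by split=> //; rewrite ?sqrtr_gt0 ?divr_gt0// !lt_min dl00 dl10 invr_gt0 ltr01.
move=> delta n mu nu sg delta0; rewrite !le_min => /andP[/andP[d1 dle0] /andP[dle1 dle2]] _ _ sgs.
move=> rho rho' [B [X0 [mX0 hX0 ->]]] [B' [X0' [mX0' hX0' ->]]].
(* The first increment of one basis serves as reference; by uniqueness on boxes every increment of
   every basis has this law. *)
pose g := law (bb_P B) (@measurable_increment R d delta delta0 B 0).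
have gauss B'' k A : measurable A ->
    bb_P B'' ((fun w => bb_W B'' (k.+1%:R * delta) w - bb_W B'' (k%:R * delta) w)
      @^-1` A) = g A.
  move=> mA.
  apply: (@probability_rV_unique R d (law (bb_P B'') (@measurable_increment R d delta delta0 B'' k)) g) => // a ma.
  transitivity (\prod_(i < d) normal_prob 0 (Num.sqrt delta) (a i))%E.
    exact: increment_gaussian.
  by symmetry; exact: increment_gaussian.
have gE (i : 'I_d) (A : set R) : measurable A ->
    g [set u : 'rV[R]_d | A (u ord0 i)] = normal_prob 0 (Num.sqrt delta) A.
  move=> mA; rewrite -(prod_normal_prob_one _ i).
  rewrite -(@increment_gaussian R d delta delta0 B 0); last by move=> j; case: ifP.
  congr (g _); apply/seteqP; split => u /=.
    by move=> Au j; case: eqP => [->|].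
  by move/(_ i); rewrite eqxx.
have [V [mV V12 qV]] := hV delta sg g delta0 dle1 sgs gE.
have cd : c * delta <= 1 by rewrite mulrC -ler_pdivlMr// mul1r.
have th0 : 0 < 1 - c / 2 * delta by lra.
rewrite (eq_W2 (mu' := chain sg g (mstep delta delta0 d1) mu n)
  (nu' := chain sg g (mstep delta delta0 d1) nu n)); last 2 first.
- by move=> A mA; apply: scheme_chain => // k A' mA'; exact: gauss.
- by move=> A mA; apply: scheme_chain => // k A' mA'; exact: gauss.
apply: le_trans (W2_chain (mstep delta delta0 d1) mu nu n V12 mV th0
  (hstep _ delta0 dle0) qV) _.
apply: lee_wpmul2r; first exact: W2_ge0.
by rewrite lee_fin sqrt_geometric_le// ltW.
Qed.

(** * The two schemes *)

Lemma powR_small (R : realType) (a eps : R) : 0 < a -> 0 < eps ->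
  exists2 delta0, 0 < delta0 &
    forall delta, 0 < delta -> delta <= delta0 -> delta `^ a <= eps.
Proof.
move=> a0 e0; exists (eps `^ a^-1); first by rewrite powR_gt0.
move=> delta dl0 dl; apply: le_trans (_ : (eps `^ a^-1) `^ a <= _).
  by apply: ge0_ler_powR => //; rewrite ?nnegrE ?powR_ge0 ?ltW.
by rewrite -powRrM mulVf ?gt_eqF// powRr1// ltW.
Qed.

Lemma powR_le1 (R : realType) (delta a : R) : 0 < delta -> delta <= 1 ->
  0 <= a -> delta `^ a <= 1.
Proof.
move=> dl0 dl1 a0; rewrite (_ : 1 = 1 `^ a); last by rewrite powR1.
by apply: ge0_ler_powR => //; rewrite ?nnegrE// ltW.
Qed.

Lemma enorm_powR_le (R : realType) (d : nat) (l rho : R) (x : 'rV[R]_d) :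
  0 <= l -> enorm x <= rho -> enorm x `^ l <= rho `^ l.
Proof.
move=> l0 xr; apply: ge0_ler_powR => //; rewrite ?nnegrE ?enorm_ge0//.
exact: le_trans (enorm_ge0 x) xr.
Qed.

(* With w = delta^(1-gamma) and v = delta^(1-2gamma): delta = t w and
   w^2 = delta v for t = delta^gamma. *)
Lemma step_size_powers (R : realType) (gamma delta : R) : 0 < gamma < 2^-1 ->
  0 < delta ->
  delta `^ gamma * delta `^ (1 - gamma) = delta /\
  delta `^ (1 - gamma) ^+ 2 = delta * delta `^ (1 - 2 * gamma).
Proof.
move=> /andP[g0 g1] dl0; have dl := gt_eqF dl0.
have powD a b : delta `^ a * delta `^ b = delta `^ (a + b).
  by rewrite -powRD// dl implybT.
split; first by rewrite powD addrC subrK powRr1// ltW.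
rewrite expr2 powD -[X in X * _](powRr1 (ltW dl0)) powD.
by congr (_ `^ _); ring.
Qed.

(** The form [rho / 2 - 1] is what a displacement of at most (1 + |x|)/2 leaves. The hypothesis is
    used at two radii, a large one for near points and 2 S' + 2 for far ones, where (2 S' + 2)/2 - 1
    = S' = sqrt d * S accounts for the passage to the sup norm. *)
Lemma confined_of_enorm (R : realType) (d : nat)
    (step : R -> 'rV[R]_d -> 'rV[R]_d) : (0 < d)%N ->
  (forall rho, 0 < rho -> exists C delta0 : R, [/\ 0 < C, 0 < delta0 &
     forall delta, 0 < delta -> delta <= delta0 -> forall x,
       (enorm x <= rho -> enorm (step delta x - x) <= C * delta) /\
       (rho < enorm x -> rho / 2 - 1 <= enorm (step delta x))]) ->
  confined step.
Proof.
move=> d0 h S S0; have sd : 0 < Num.sqrt d%:R :> R by rewrite sqrtr_gt0 ltr0n.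
pose S' := Num.sqrt d%:R * S; have S'0 : 0 < S' by rewrite mulr_gt0.
pose S2 := 2 * S' + 2 + S; have S20 : 0 < S2 by rewrite /S2; lra.
have [C [dl1 [C0 dl10 h1]]] := h (Num.sqrt d%:R * S2) (mulr_gt0 sd S20).
have far0 : 0 < 2 * S' + 2 by lra.
have [C' [dl2 [C'0 dl20 h2]]] := h (2 * S' + 2) far0.
exists C, S2, (Num.min dl1 dl2); split => //.
- by rewrite /S2; lra.
- by rewrite lt_min dl10.
move=> delta delta0; rewrite le_min => /andP[dle1 dle2] x; split => xS.
  apply: le_trans (normr_le_enorm _) _; apply: (h1 _ delta0 dle1 x).1.
  by apply: le_trans (enorm_le_normr x) _; rewrite ler_pM2l.
rewrite -(ler_pM2l sd) -/S'; apply: le_trans (enorm_le_normr _).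
have -> : S' = (2 * S' + 2) / 2 - 1 by field.
apply: (h2 _ delta0 dle2 x).2.
by have := normr_le_enorm x; move: xS; rewrite /S2; lra.
Qed.

(** With t = delta^gamma, one factor t turns the growth of the numerator into that of the
    denominator (1 + tX)(1 + tY): the tamed drift is Lipschitz with constant O(1/t). *)
Lemma tamed_numerator_le (R : realType) (t X Y L0 L1 : R) :
  0 <= t -> t <= 1 -> 0 <= X -> 0 <= Y -> 0 <= L0 -> 0 <= L1 ->
  t * (L0 * (1 + X + Y) + t * (L1 * (1 + X + Y + X * Y))) <=
  (L0 + 2 * L1) * ((1 + t * X) * (1 + t * Y)).
Proof.
move=> t0 t1 X0 Y0 L00 L10.
have tX : 0 <= t * X by exact: mulr_ge0.
have tY : 0 <= t * Y by exact: mulr_ge0.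
have tXY : 0 <= t * X * (t * Y) by exact: mulr_ge0.
have e1 : t * (1 + X + Y) <= (1 + t * X) * (1 + t * Y) by lra.
have tt : t * t <= t by rewrite ler_piMl.
have ttX : t * (t * X) <= t * X by rewrite ler_piMl.
have ttY : t * (t * Y) <= t * Y by rewrite ler_piMl.
have e2 : t * (t * (1 + X + Y + X * Y)) <= 2 * ((1 + t * X) * (1 + t * Y)) by lra.
by have := ler_wpM2l L00 e1; have := ler_wpM2l L10 e2; lra.
Qed.

(** For small t the L3 term uses up half of the L2 dissipation; the other half and the L4 term
    dominate 1 + X + Y + tXY, which is at least the denominator. *)
Lemma tamed_dissipation_le (R : realType) (t X Y L2 L3 L4 c : R) :
  0 <= t -> t <= 1 -> 0 <= X -> 0 <= Y -> 0 < L3 -> 0 <= c ->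
  c <= L2 / 2 -> c <= L4 -> t <= L2 / (2 * L3) ->
  - L2 * (1 + X + Y) + t * (L3 * (1 + X + Y) - L4 * X * Y) <=
  - c * ((1 + t * X) * (1 + t * Y)).
Proof.
move=> t0 t1 X0 Y0 L30 c0 cL2 cL4 tL.
have XYp : 0 <= 1 + X + Y by rewrite !addr_ge0.
have tXY : 0 <= t * (X * Y) by rewrite !mulr_ge0.
have e1 : t * L3 * (1 + X + Y) <= L2 / 2 * (1 + X + Y).
  apply: ler_wpM2r => //.
  by move: tL; rewrite ler_pdivlMr ?mulr_gt0//; lra.
have e2 := ler_wpM2r XYp cL2; have e3 := ler_wpM2r tXY cL4.
have e4 : (1 + t * X) * (1 + t * Y) <= 1 + X + Y + t * (X * Y).
  have : 0 <= (1 - t) * (X + Y + t * (X * Y)).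
    by apply: mulr_ge0; [rewrite subr_ge0|rewrite !addr_ge0].
  by lra.
by have e5 := ler_wpM2l c0 e4; lra.
Qed.

(** * Metric projection onto a Euclidean ball *)

Section radial_projection.
Variables (R : realType) (d : nat).
Implicit Types (x y z : 'rV[R]_d) (r : R).

Definition radial_proj r x := if enorm x <= r then x else (r / enorm x) *: x.

Lemma enorm_radial_proj r x : 0 <= r -> r < enorm x ->
  enorm (radial_proj r x) = r.
Proof.
move=> r0 rx; rewrite /radial_proj (lt_geF rx) enormZ.
have x0 : 0 < enorm x by exact: le_lt_trans rx.
by rewrite ger0_norm ?divfK ?gt_eqF// divr_ge0// ltW.
Qed.

Lemma enorm_radial_proj_le r x : 0 <= r -> enorm (radial_proj r x) <= r.
Proof.
move=> r0; have [rx|rx] := leP (enorm x) r; last by rewrite enorm_radial_proj.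
by rewrite /radial_proj rx.
Qed.

(** Obtuse-angle property of the projection onto a convex set: x - p is a nonnegative multiple of x,
    and Cauchy-Schwarz does the rest. *)
Lemma radial_proj_variational r x z : 0 <= r -> enorm z <= r ->
  inner (x - radial_proj r x) (z - radial_proj r x) <= 0.
Proof.
move=> r0 zr; have [rx|rx] := leP (enorm x) r.
  by rewrite /radial_proj rx subrr -(scale0r 0) innerZl mul0r.
rewrite /radial_proj (lt_geF rx).
have x0 : 0 < enorm x by exact: le_lt_trans rx.
set k := r / enorm x.
have k1 : k <= 1 by rewrite ler_pdivrMr// mul1r ltW.
have -> : x - k *: x = (1 - k) *: x by rewrite scalerBl scale1r.
have -> : z - k *: x = z + (- k) *: x by rewrite scaleNr.
rewrite innerZl innerDr innerZr -enorm_sqr; apply: mulr_ge0_le0.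
  by rewrite subr_ge0.
have -> : - k * enorm x ^+ 2 = - (r * enorm x).
  by rewrite expr2 mulrA mulNr divfK ?gt_eqF// mulNr.
rewrite subr_le0; apply: le_trans (cauchy_schwarz x z) _.
by rewrite mulrC ler_wpM2r// enorm_ge0.
Qed.

(* Expanding |x - y|^2 around the difference of the projections, the cross
   terms are nonnegative by the variational inequality at x and at y. *)
Lemma radial_proj_nonexpansive r x y : 0 <= r ->
  enorm (radial_proj r x - radial_proj r y) <= enorm (x - y).
Proof.
move=> r0; set p := radial_proj r x; set q := radial_proj r y.
have h1 : inner (x - p) (q - p) <= 0.
  by apply: radial_proj_variational => //; exact: enorm_radial_proj_le.
have h2 : inner (y - q) (p - q) <= 0.
  by apply: radial_proj_variational => //; exact: enorm_radial_proj_le.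
rewrite -ler_sqr ?nnegrE ?enorm_ge0//.
have -> : x - y = (p - q) + ((x - p) - (y - q)).
  by apply/rowP => i; rewrite !mxE; ring.
rewrite (enormD_sqr (p - q)); have := sqr_ge0 (enorm (x - p - (y - q))).
have -> : inner (p - q) (x - p - (y - q)) =
    - inner (x - p) (q - p) - inner (y - q) (p - q).
  move: (x - p) (y - q) => a c; rewrite innerDr -(scaleN1r c) innerZr.
  rewrite !(innerC (p - q)) -(opprB p q) -(scaleN1r (p - q)) innerZr.
  by ring.
by lra.
Qed.

End radial_projection.

(** [phi] is injective on the nonnegative reals for l0 > 0, and v >= 1 puts v in its image, where
    the partial inverse is a true one. *)
Lemma phi_invE (R : realType) (l0 v : R) : 0 < l0 -> 1 <= v ->
  phi_inv l0 v = (v - 1) `^ l0^-1.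
Proof.
move=> l0_gt0 v1; set r := (v - 1) `^ l0^-1.
have r0 : 0 <= r by exact: powR_ge0.
have -> : v = phi l0 r.
  rewrite /phi /r -powRrM mulVf ?gt_eqF// powRr1 ?subr_ge0//.
  by rewrite addrC subrK.
rewrite /phi_inv pinvKV// ?inE// => x y; rewrite !inE/= => x0 y0 /addrI.
exact: powR_injective.
Qed.

Lemma enorm_lipschitz_continuous (R : realType) (d : nat)
    (f : 'rV[R]_d -> 'rV[R]_d) :
  (forall x y, enorm (f x - f y) <= enorm (x - y)) -> continuous f.
Proof.
move=> fl x P /= /nbhs_normP[e /= e0 eP].
suff : nbhs x (f @^-1` P) by [].
apply/(@nbhs_normP R 'rV[R]_d).
have sd : 0 < 1 + Num.sqrt d%:R :> R by rewrite ltr_pwDl ?sqrtr_ge0.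
exists (e / (1 + Num.sqrt d%:R)) => /=; first by rewrite divr_gt0.
move=> y /=; rewrite ltr_pdivlMr// => xy; apply: eP => /=.
apply: le_lt_trans xy; apply: le_trans (normr_le_enorm _) _.
apply: le_trans (fl x y) _; apply: le_trans (enorm_le_normr _) _.
by rewrite mulrC ler_wpM2l// lerDr.
Qed.

Section drift.
Variables (R : realType) (d : nat) (b : 'rV[R]_d -> 'rV[R]_d).
Variables (gamma L0 l0 : R).
Hypotheses (d0 : (0 < d)%N) (mb : measurable_fun setT b)
  (hgamma : 0 < gamma < 2^-1) (hL0 : 0 < L0) (hl0 : 0 <= l0).
Hypothesis hb : forall x y : 'rV[R]_d, enorm (b x - b y) <=
  L0 * (1 + enorm x `^ l0 + enorm y `^ l0) * enorm (x - y).

Local Notation pw x := (enorm x `^ l0).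

Let growth_const : R := enorm (b 0) + 2 * L0.

Let growth_const_gt0 : 0 < growth_const.
Proof. by rewrite /growth_const; have := enorm_ge0 (b 0); move: hL0; lra. Qed.

Lemma drift_growth x : enorm (b x) <= growth_const * (1 + pw x) * (1 + enorm x).
Proof.
(* The power is 1 for l0 = 0 and 0 otherwise. *)
have h0 : (0 : R) `^ l0 <= 1.
  by have [->|/powR0 ->] := eqVneq l0 0; rewrite ?powRr0.
have := enorm_le_sub (b x) (b 0); have := hb x 0.
rewrite enorm0 subr0 => h1 h2.
have X0 : 0 <= pw x by exact: powR_ge0.
have x0 := enorm_ge0 x; have b0 := enorm_ge0 (b 0).
have h3 : L0 * (1 + pw x + 0 `^ l0) * enorm x <= 2 * L0 * ((1 + pw x) * enorm x).
  have : 0 <= L0 * ((1 - 0 `^ l0 + pw x) * enorm x).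
    by apply: mulr_ge0; [exact: ltW|apply: mulr_ge0 => //; lra].
  lra.
have h4 : 0 <= enorm (b 0) * ((1 + pw x) * (1 + enorm x) - 1).
  apply: mulr_ge0 => //; have : 0 <= pw x * enorm x by exact: mulr_ge0.
  lra.
have h5 : 0 <= 2 * L0 * (1 + pw x).
  by apply: mulr_ge0; [move: hL0; lra|lra].
rewrite /growth_const; lra.
Qed.

Let delta_facts delta : 0 < delta -> delta <= 1 ->
  let t := delta `^ gamma in let w := delta `^ (1 - gamma) in
  let v := delta `^ (1 - 2 * gamma) in
  [/\ 0 < t, t <= 1, 0 < w, t * w = delta & w ^+ 2 = delta * v].
Proof.
move=> dl0 dl1 t w v; have [h1 h2] := step_size_powers hgamma dl0.
have /andP[g0 _] := hgamma.
by split; rewrite ?powR_gt0// powR_le1// ltW.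
Qed.

(** * The tamed scheme *)

Section tamed.
Variables (L1 L2 L3 L4 Rs : R).
Hypotheses (L10 : 0 < L1) (L20 : 0 < L2) (L30 : 0 < L3) (L40 : 0 < L4)
  (Rs0 : 0 <= Rs).
Hypothesis hL1 : forall x y : 'rV[R]_d, enorm (pw y *: b x - pw x *: b y) <=
  L1 * (1 + pw x + pw y + pw x * pw y) * enorm (x - y).
Hypothesis hout : forall x y : 'rV[R]_d, Rs < enorm x \/ Rs < enorm y ->
  inner (x - y) (b x - b y) <= - L2 * (1 + pw x + pw y) * enorm (x - y) ^+ 2 /\
  inner (x - y) (pw y *: b x - pw x *: b y) <=
    (L3 * (1 + pw x + pw y) - L4 * pw x * pw y) * enorm (x - y) ^+ 2.

Lemma measurable_tamed_step delta : measurable_fun setT (tamed_step b gamma l0 delta).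
Proof.
have -> : tamed_step b gamma l0 delta =
    (fun x => x + delta *: ((1 + delta `^ gamma * pw x) `^ (-1) *: b x)).
  apply/funext => x; rewrite powR_inv1//.
  by rewrite addr_ge0// mulr_ge0 ?powR_ge0.
apply: measurable_rVD => //; apply: measurable_rVZ => //.
apply: measurable_rVZ => //.
apply: (measurableT_comp (@measurable_powR R (-1))).
apply: measurable_funD => //; apply: measurable_funM => //.
exact: measurableT_comp (measurable_powR l0) (@measurable_enorm R d).
Qed.

(** Since t(1 + X) <= 1 + tX, the displacement is at most delta^(1 - gamma) times linear growth,
    hence at most (1 + |x|)/2 for small delta. *)
Lemma tamed_confined : confined (tamed_step b gamma l0).
Proof.
apply: confined_of_enorm => // rho rho0.
have Cg0 := growth_const_gt0.
have [/andP[g0 g1]] := hgamma.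
have ga : 0 < 1 - gamma by lra.
have eps0 : 0 < (2 * growth_const)^-1 by rewrite invr_gt0 mulr_gt0.
have [dl1 dl10 hw] := powR_small ga eps0.
exists (growth_const * (1 + rho `^ l0) * (1 + rho)), (Num.min 1 dl1).
have rl0 : 0 <= rho `^ l0 by exact: powR_ge0.
split.
- by rewrite !mulr_gt0//; lra.
- by rewrite lt_min ltr01.
move=> delta delta0; rewrite le_min => /andP[dle1 dle2] x.
have [t0 t1 w0 tw _] := delta_facts delta0 dle1.
have wC := hw _ delta0 dle2.
set t := delta `^ gamma in t0 t1 tw; set w := delta `^ (1 - gamma) in w0 tw wC.
have X0 : 0 <= pw x by exact: powR_ge0.
have x0 := enorm_ge0 x; have gr := drift_growth x.
have D0 : 0 < 1 + t * pw x by rewrite ltr_wpDr// mulr_ge0// ltW.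
have stepE : tamed_step b gamma l0 delta x - x = (delta / (1 + t * pw x)) *: b x.
  by rewrite /tamed_step /tamed_drift addrC addKr scalerA.
have stepn : enorm (tamed_step b gamma l0 delta x - x) =
    delta / (1 + t * pw x) * enorm (b x).
  by rewrite stepE enormZ ger0_norm//; apply: divr_ge0; exact: ltW.
split => xr.
  rewrite stepn.
  have : delta / (1 + t * pw x) <= delta.
    rewrite ler_pdivrMr// ler_peMr//; first exact: ltW.
    by rewrite lerDl mulr_ge0// ltW.
  move=> /(ler_wpM2r (enorm_ge0 (b x)))/le_trans; apply.
  rewrite mulrC ler_pM2r//; apply: le_trans gr _.
  apply: ler_pM; [by apply: mulr_ge0; [exact: ltW|exact: addr_ge0]|exact: addr_ge0| |lra].
  by rewrite ler_pM2l// lerD2l enorm_powR_le.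
have big : enorm (tamed_step b gamma l0 delta x - x) <= (1 + enorm x) / 2.
  rewrite stepn mulrAC ler_pdivrMr//.
  apply: (@le_trans _ _ (delta * (growth_const * (1 + pw x) * (1 + enorm x)))).
    by rewrite ler_pM2l.
  have -> : delta * (growth_const * (1 + pw x) * (1 + enorm x)) =
     (w * growth_const) * (t * (1 + pw x)) * (1 + enorm x) by rewrite -tw; ring.
  have -> : (1 + enorm x) / 2 * (1 + t * pw x) =
     2^-1 * (1 + t * pw x) * (1 + enorm x) by ring.
  apply: ler_wpM2r; first by rewrite addr_ge0.
  apply: ler_pM.
  - by apply: mulr_ge0; exact: ltW.
  - by apply: mulr_ge0; [exact: ltW|rewrite addr_ge0].
  - by rewrite -ler_pdivlMr// -invfM.
  - lra.
have := enorm_le_sub x (tamed_step b gamma l0 delta x); rewrite enormB.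
by lra.
Qed.

(** Over the common denominator the tamed drifts differ by (b x - b y) + t(|y|^l0 b x - |x|^l0 b y),
    the two expressions that the hypotheses control. *)
Lemma tamed_stepB delta x y :
  let t := delta `^ gamma in
  tamed_step b gamma l0 delta x - tamed_step b gamma l0 delta y =
  (x - y) + (delta / ((1 + t * pw x) * (1 + t * pw y))) *:
    ((b x - b y) + t *: (pw y *: b x - pw x *: b y)).
Proof.
move=> t; rewrite /tamed_step /tamed_drift -/t opprD addrACA; congr (_ + _).
rewrite -scalerBr -scalerA; congr (_ *: _).
have : 0 < 1 + t * pw x by rewrite ltr_wpDr// mulr_ge0 ?powR_ge0.
have : 0 < 1 + t * pw y by rewrite ltr_wpDr// mulr_ge0 ?powR_ge0.
move: (pw x) (pw y) t => X Y t DY DX.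
apply/rowP => i; rewrite !mxE; field.
by rewrite (gt_eqF DX) (gt_eqF DY).
Qed.

Lemma tamed_contractive : contractive_outside_ball (tamed_step b gamma l0).
Proof.
move: (hL0) (L10) (L20) (L30) (L40) (Rs0) =>
  l0_gt0 l1_gt0 l2_gt0 l3_gt0 l4_gt0 Rs_ge0.
pose c := Num.min (L2 / 2) L4.
have c0 : 0 < c by rewrite lt_min divr_gt0.
have cL2 : c <= L2 / 2 by rewrite ge_min lexx.
have cL4 : c <= L4 by rewrite ge_min lexx orbT.
have /andP[g0 g1] := hgamma.
pose rs := Rs `^ l0; have rs0 : 0 <= rs by exact: powR_ge0.
pose M := L0 * (1 + rs + rs) + L1 * (1 + rs + rs + rs * rs).
have M0 : 0 <= M.
  by rewrite addr_ge0// mulr_ge0 ?addr_ge0 ?mulr_ge0// ltW.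
pose A := L0 + 2 * L1; have A0 : 0 < A by rewrite /A; lra.
have L23 : 0 < L2 / (2 * L3) by rewrite divr_gt0// mulr_gt0.
have [dl1 dl10 ht] := powR_small g0 L23.
have gb : 0 < 1 - 2 * gamma by lra.
have cA : 0 < c / A ^+ 2 by rewrite divr_gt0// exprn_gt0.
have [dl2 dl20 hv] := powR_small gb cA.
(* When both points have norm at most Rs the factor is 1 + c delta + 2 M delta = 1 - c delta + (2M +
   2c) delta. The radius is Rs + 1 because it must be positive and Rs may be 0. *)
exists c, (2 * M + 2 * c), (Rs + 1), (Num.min 1 (Num.min dl1 dl2)).
split => //; [by lra|by lra|by rewrite !lt_min ltr01 dl10|].
move=> delta delta0; rewrite !le_min => /and3P[dle1 dle2 dle3] x y.
have [t0 t1 w0 tw wv] := delta_facts delta0 dle1.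
have tL := ht _ delta0 dle2; have vA := hv _ delta0 dle3.
have X0 : 0 <= pw x by exact: powR_ge0.
have Y0 : 0 <= pw y by exact: powR_ge0.
have hbxy := hb x y; have hLxy := hL1 x y; have hxy := @hout x y.
have Xle : enorm x <= Rs -> pw x <= rs by exact: enorm_powR_le.
have Yle : enorm y <= Rs -> pw y <= rs by exact: enorm_powR_le.
have stepE := tamed_stepB delta x y; cbv zeta in stepE.
(* The real powers become variables, and only polynomial arithmetic remains. *)
move: (delta `^ gamma) (delta `^ (1 - gamma)) (delta `^ (1 - 2 * gamma))
  (pw x) (pw y) t0 t1 w0 tw wv tL vA X0 Y0 hbxy hLxy hxy Xle Yle stepE.
move=> t w v X Y t0 t1 w0 tw wv tL vA X0 Y0 hbxy hLxy hxy Xle Yle.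
have XY0 : 0 <= X * Y by exact: mulr_ge0.
have DX : 1 <= 1 + t * X by rewrite lerDl; apply: mulr_ge0 => //; exact: ltW.
have DY : 1 <= 1 + t * Y by rewrite lerDl; apply: mulr_ge0 => //; exact: ltW.
have D1 : 1 <= (1 + t * X) * (1 + t * Y).
  by rewrite -[leLHS]mul1r; apply: ler_pM.
have num : t * (L0 * (1 + X + Y) + t * (L1 * (1 + X + Y + X * Y))) <=
    A * ((1 + t * X) * (1 + t * Y)).
  by apply: tamed_numerator_le => //; exact: ltW.
have dis : - L2 * (1 + X + Y) + t * (L3 * (1 + X + Y) - L4 * X * Y) <=
    - c * ((1 + t * X) * (1 + t * Y)).
  by apply: tamed_dissipation_le => //; exact: ltW.
move: ((1 + t * X) * (1 + t * Y)) D1 num dis => D D1 num dis.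
have D0 : 0 < D by exact: lt_le_trans D1.
set u := (b x - b y) + t *: (Y *: b x - X *: b y).
set z := x - y in hbxy hLxy hxy *.
move=> stepE.
have z2 : 0 <= enorm z ^+ 2 by exact: sqr_ge0.
have un : enorm u <= (L0 * (1 + X + Y) + t * (L1 * (1 + X + Y + X * Y))) * enorm z.
  apply: le_trans (enormD _ _) _; rewrite enormZ (gtr0_norm t0) mulrDl.
  apply: lerD => //.
  by rewrite -mulrA ler_pM2l.
have uA : w * enorm u * t <= w * A * D * enorm z.
  rewrite -!mulrA ler_pM2l// mulrC mulrA.
  apply: le_trans (ler_wpM2l (ltW t0) un) _.
  by rewrite [leLHS]mulrA; apply: ler_wpM2r num; exact: enorm_ge0.
(* The squared drift costs A^2 delta^(1 - 2 gamma) delta, at most c delta: half of the dissipation 2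
   c delta of the cross term. *)
have quad : (delta / D * enorm u) ^+ 2 <= c * delta * enorm z ^+ 2.
  have h1 : delta / D * enorm u <= w * A * enorm z.
    by rewrite mulrAC ler_pdivrMr// -tw; move: uA; lra.
  apply: (@le_trans _ _ ((w * A * enorm z) ^+ 2)).
    rewrite ler_sqr ?nnegrE//; first by apply: mulr_ge0; [apply: divr_ge0; exact: ltW|exact: enorm_ge0].
    by apply: mulr_ge0; [apply: mulr_ge0; exact: ltW|exact: enorm_ge0].
  rewrite !exprMn wv; apply: ler_wpM2r => //.
  by rewrite -mulrA mulrC ler_pM2r// -ler_pdivlMr// exprn_gt0.
have main : enorm (z + (delta / D) *: u) ^+ 2 <=
    (1 + c * delta) * enorm z ^+ 2 + 2 * (delta * (inner z u / D)).
  rewrite enormD_sqr innerZr enormZ (ger0_norm (_ : 0 <= delta / D)); last first.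
    by apply: divr_ge0; exact: ltW.
  have -> : 2 * (delta / D * inner z u) = 2 * (delta * (inner z u / D)) by ring.
  by rewrite mulrDl mul1r; lra.
rewrite stepE; apply: le_trans main _.
have outcase : Rs < enorm x \/ Rs < enorm y ->
    (1 + c * delta) * enorm z ^+ 2 + 2 * (delta * (inner z u / D)) <=
    (1 - c * delta) * enorm z ^+ 2.
  move=> /hxy[h1 h2].
  have iu : inner z u / D <= - c * enorm z ^+ 2.
    rewrite ler_pdivrMr// mulrAC.
    rewrite /u innerDr innerZr.
    apply: (@le_trans _ _ ((- L2 * (1 + X + Y) +
        t * (L3 * (1 + X + Y) - L4 * X * Y)) * enorm z ^+ 2)).
      rewrite mulrDl; apply: lerD; first exact: h1.
      by rewrite -[leRHS]mulrA ler_pM2l.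
    exact: ler_wpM2r.
  have := ler_wpM2l (ltW delta0) iu; lra.
have ind0 : 0 <= inside (Rs + 1) x by exact: inside_ge0.
have [xR|xR] := ltP Rs (enorm x).
  apply: le_trans (outcase (or_introl xR)) _; apply: ler_wpM2r => //.
  by rewrite lerDl; apply: mulr_ge0 => //; apply: mulr_ge0; lra.
have [yR|yR] := ltP Rs (enorm y).
  apply: le_trans (outcase (or_intror yR)) _; apply: ler_wpM2r => //.
  by rewrite lerDl; apply: mulr_ge0 => //; apply: mulr_ge0; lra.
have -> : inside (Rs + 1) x = 1.
  rewrite /inside; have -> // : `|x| <= Rs + 1.
  by apply: le_trans (normr_le_enorm x) _; lra.
have Xr := Xle xR; have Yr := Yle yR.
have uM : enorm u <= M * enorm z.
  apply: le_trans un _; apply: ler_wpM2r; first exact: enorm_ge0.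
  have XYr : X * Y <= rs * rs by exact: ler_pM.
  rewrite /M; apply: lerD; first by rewrite ler_pM2l//; lra.
  apply: (@le_trans _ _ (1 * (L1 * (1 + X + Y + X * Y)))).
    by apply: ler_wpM2r => //; apply: mulr_ge0; [exact: ltW|rewrite !addr_ge0].
  by rewrite mul1r ler_pM2l//; lra.
have iu : inner z u / D <= M * enorm z ^+ 2.
  rewrite ler_pdivrMr//; apply: le_trans (cauchy_schwarz z u) _.
  apply: (@le_trans _ _ (M * enorm z ^+ 2)).
    by rewrite mulrC expr2 mulrA ler_wpM2r// enorm_ge0.
  by rewrite ler_peMr// mulr_ge0.
have := ler_wpM2l (ltW delta0) iu; lra.
Qed.

End tamed.

(** * The projected scheme *)

Lemma projectionE delta : 0 < delta -> delta <= 1 ->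
  (l0 = 0 /\ @projection R d gamma l0 delta = id) \/
  exists r, [/\ 0 < l0, 0 <= r, delta `^ gamma * (1 + r `^ l0) = 1 &
    @projection R d gamma l0 delta = radial_proj r].
Proof.
move=> dl0 dl1; have [l00|l00] := eqVneq l0 0.
  left; split => //; apply/funext => x; rewrite /projection l00 eqxx.
  by case: eqP => [->|].
have l0_gt0 : 0 < l0 by rewrite lt_neqAle eq_sym l00.
have [t0 t1 _ _ _] := delta_facts dl0 dl1.
(* For delta <= 1 the level delta^-gamma lies in the image of [phi], so the radius solves phi(r) =
   delta^-gamma. *)
have v1 : 1 <= delta `^ (- gamma) by rewrite powRN invf_ge1.
right; exists ((delta `^ (- gamma) - 1) `^ l0^-1); split => //.
- exact: powR_ge0.
- rewrite -powRrM mulVf// powRr1 ?subr_ge0// addrC subrK powRN.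
  by rewrite mulfV// gt_eqF.
apply/funext => x; rewrite /projection phi_invE// (negbTE l00) /radial_proj.
set r := (_ `^ l0^-1); have r0 : 0 <= r by exact: powR_ge0.
have [->|x0] := eqVneq x 0; first by rewrite enorm0 r0.
have ex0 : enorm x != 0 by apply: contra_neq x0; exact: enorm_eq0.
have [xr|xr] := leP (enorm x) r.
  by rewrite mulVf// scale1r.
by rewrite mulrC.
Qed.

Lemma projection_nonexpansive delta (x y : 'rV[R]_d) : 0 < delta -> delta <= 1 ->
  enorm (projection gamma l0 delta x - projection gamma l0 delta y) <=
  enorm (x - y).
Proof.
move=> dl0 dl1; have [[_ ->//]|[r [_ r0 _ ->]]] := projectionE dl0 dl1.
exact: radial_proj_nonexpansive.
Qed.

(** Truncation keeps the Lipschitz constant of the drift at order delta^-gamma. The bound would be 1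
    for l0 > 0; the 2 accommodates l0 = 0, where 1 + |x|^0 = 2. *)
Lemma projection_powR_le delta (x : 'rV[R]_d) : 0 < delta -> delta <= 1 ->
  delta `^ gamma * (1 + pw (projection gamma l0 delta x)) <= 2.
Proof.
move=> dl0 dl1; have [t0 t1 _ _ _] := delta_facts dl0 dl1.
have [[l00 _]|[r [_ r0 tr ->]]] := projectionE dl0 dl1.
  by rewrite l00 powRr0; lra.
have : pw (radial_proj r x) <= r `^ l0.
  by apply: enorm_powR_le => //; exact: enorm_radial_proj_le.
by move=> /(ler_wpM2l (ltW t0)); lra.
Qed.

(** The truncation radius r exceeds rho once delta^gamma (2 + rho^l0) <= 1, because delta^gamma (1 +
    r^l0) = 1. *)
Lemma projection_id_on_ball (rho : R) : 0 < rho ->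
  exists2 delta0, 0 < delta0 & forall delta, 0 < delta -> delta <= delta0 ->
    forall x : 'rV[R]_d,
      (enorm x <= rho -> projection gamma l0 delta x = x) /\
      (rho < enorm x -> rho <= enorm (projection gamma l0 delta x)).
Proof.
move=> rho0; have /andP[g0 g1] := hgamma.
have rl0 : 0 <= rho `^ l0 by exact: powR_ge0.
have eps1 : 0 < 2 + rho `^ l0 by lra.
have eps0 : 0 < (2 + rho `^ l0)^-1 by rewrite invr_gt0.
have [dl1 dl10 ht] := powR_small g0 eps0.
exists (Num.min 1 dl1); first by rewrite lt_min ltr01.
move=> delta dl0; rewrite le_min => /andP[dle1 dle2] x.
have [t0 t1 _ _ _] := delta_facts dl0 dle1.
have [[_ ->]|[r [l0_gt0 r0 tr ->]]] := projectionE dl0 dle1.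
  by split => //; exact: ltW.
have rr : rho < r.
  rewrite ltNge; apply/negP => rrho.
  have : r `^ l0 <= rho `^ l0.
    by apply: ge0_ler_powR => //; rewrite nnegrE// ltW.
  have := ht _ dl0 dle2; rewrite -(ler_pM2r eps1) mulVf ?gt_eqF//.
  by move=> h1 /(ler_wpM2l (ltW t0)); lra.
split => xr; first by rewrite /radial_proj (le_trans xr (ltW rr)).
have [xr'|xr'] := leP (enorm x) r; last by rewrite enorm_radial_proj// ltW.
by rewrite /radial_proj xr' ltW.
Qed.

Lemma measurable_projected_step delta : 0 < delta -> delta <= 1 ->
  measurable_fun setT (projected_step b gamma l0 delta).
Proof.
move=> dl0 dl1.
have mp : measurable_fun setT (@projection R d gamma l0 delta).
  apply: continuous_measurable_rV_rV; apply: enorm_lipschitz_continuous => x y.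
  exact: projection_nonexpansive.
apply: measurable_rVD => //; apply: measurable_rVZ => //.
exact: measurableT_comp mb mp.
Qed.

(** The displacement from the projected point p is at most (1 + |p|)/2: the factor 2 of
    [projection_powR_le] is offset by delta^(1 - gamma) <= 1/(4 growth_const). *)
Lemma projected_confined : confined (projected_step b gamma l0).
Proof.
apply: confined_of_enorm => // rho rho0.
have Cg0 := growth_const_gt0.
have /andP[g0 g1] := hgamma.
have ga : 0 < 1 - gamma by lra.
have eps0 : 0 < (4 * growth_const)^-1 by rewrite invr_gt0 mulr_gt0.
have [dl1 dl10 hw] := powR_small ga eps0.
have [dl2 dl20 hp] := projection_id_on_ball rho0.
have rl0 : 0 <= rho `^ l0 by exact: powR_ge0.
exists (growth_const * (1 + rho `^ l0) * (1 + rho)), (Num.min 1 (Num.min dl1 dl2)).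
split.
- by rewrite !mulr_gt0//; lra.
- by rewrite !lt_min ltr01 dl10.
move=> delta delta0; rewrite !le_min => /and3P[dle1 dle2 dle3] x.
have [t0 t1 w0 tw _] := delta_facts delta0 dle1.
have wC := hw _ delta0 dle2; have [px1 px2] := hp _ delta0 dle3 x.
have tp := projection_powR_le x delta0 dle1.
rewrite /projected_step; split => xr.
  rewrite px1// addrC addKr enormZ gtr0_norm// mulrC ler_pM2r//.
  apply: le_trans (drift_growth x) _.
  have x0 := enorm_ge0 x; have X0 : 0 <= pw x by exact: powR_ge0.
  apply: ler_pM; [by apply: mulr_ge0; [exact: ltW|exact: addr_ge0]|exact: addr_ge0| |lra].
  by rewrite ler_pM2l// lerD2l enorm_powR_le.
have {px1} {}px2 := px2 xr.
move: (projection gamma l0 delta x) px2 tp => p pr tp.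
have p0 := enorm_ge0 p; have gr := drift_growth p.
have P0 : 0 <= pw p by exact: powR_ge0.
have big : enorm (delta *: b p) <= (1 + enorm p) / 2.
  rewrite enormZ gtr0_norm//.
  apply: (@le_trans _ _ (delta * (growth_const * (1 + pw p) * (1 + enorm p)))).
    by rewrite ler_pM2l.
  rewrite -tw.
  have -> : delta `^ gamma * delta `^ (1 - gamma) *
      (growth_const * (1 + pw p) * (1 + enorm p)) =
     (delta `^ (1 - gamma) * growth_const) * (delta `^ gamma * (1 + pw p))
       * (1 + enorm p) by ring.
  rewrite [leRHS]mulrC; apply: ler_wpM2r; first by rewrite addr_ge0.
  have -> : 2^-1 = 4^-1 * 2 :> R by field.
  apply: ler_pM => //.
  - by apply: mulr_ge0; exact: ltW.
  - by apply: mulr_ge0; [exact: ltW|rewrite addr_ge0].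
  - by rewrite -ler_pdivlMr// -invfM.
have := enorm_le_sub p (p + delta *: b p).
by rewrite opprD addrA subrr add0r enormN; lra.
Qed.

(** The one-step expansion is made at the projected points p and q, and nonexpansiveness brings |p -
    q| back to |x - y|. *)
Lemma projected_contractive (Rs L5 : R) : 0 < Rs -> 0 < L5 ->
  (forall x y : 'rV[R]_d, Rs < enorm x \/ Rs < enorm y ->
     inner (x - y) (b x - b y) <= - L5 * enorm (x - y) ^+ 2) ->
  contractive_outside_ball (projected_step b gamma l0).
Proof.
move=> Rs0 L50 hout; move: (hL0) => L0_gt0; have /andP[g0 g1] := hgamma.
pose M := L0 * (1 + Rs `^ l0 + Rs `^ l0).
have rs0 : 0 <= Rs `^ l0 by exact: powR_ge0.
have M0 : 0 < M by apply: mulr_gt0 => //; lra.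
have gb : 0 < 1 - 2 * gamma by lra.
have cA : 0 < L5 / (4 * L0) ^+ 2 by rewrite divr_gt0// exprn_gt0// mulr_gt0.
have [dl1 dl10 hv] := powR_small gb cA.
have Rs1 : 0 < Rs + 1 by lra.
have [dl2 dl20 hp] := projection_id_on_ball Rs1.
exists L5, (2 * M + 2 * L5), (Rs + 1),
  (Num.min (Num.min 1 L5^-1) (Num.min dl1 dl2)).
split => //; first by lra.
  by rewrite !lt_min ltr01 dl10 invr_gt0 L50.
move=> delta delta0; rewrite !le_min => /andP[/andP[dle1 dleL] /andP[dle2 dle3]] x y.
have [t0 t1 w0 tw wv] := delta_facts delta0 dle1.
have vA := hv _ delta0 dle2.
have Ldelta : L5 * delta <= 1 by rewrite mulrC -ler_pdivlMr// mul1r.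
have := projection_nonexpansive x y delta0 dle1.
have := projection_powR_le x delta0 dle1.
have := projection_powR_le y delta0 dle1.
have [px _] := hp _ delta0 dle3 x; have [_ px2] := hp _ delta0 dle3 x.
rewrite /projected_step.
move: (projection gamma l0 delta x) (projection gamma l0 delta y) px px2.
move=> p q px px2 tq tp pq.
have step2 : (p + delta *: b p) - (q + delta *: b q) =
    (p - q) + delta *: (b p - b q).
  by rewrite opprD addrACA scalerBr.
have P0 : 0 <= pw p by exact: powR_ge0.
have Q0 : 0 <= pw q by exact: powR_ge0.
have bpq := hb p q; have opq := @hout p q.
have Ple : enorm p <= Rs -> pw p <= Rs `^ l0 by apply: enorm_powR_le.
have Qle : enorm q <= Rs -> pw q <= Rs `^ l0 by apply: enorm_powR_le.
move: (pw p) (pw q) (delta `^ gamma) (delta `^ (1 - gamma))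
  (delta `^ (1 - 2 * gamma)) P0 Q0 bpq Ple Qle t0 t1 w0 tw wv vA tp tq.
move=> P Q t w v P0 Q0 bpq Ple Qle t0 t1 w0 tw wv vA tp tq.
have z0 := enorm_ge0 (p - q).
(* 4 bounds t(1 + P) + t(1 + Q). *)
have bt : t * enorm (b p - b q) <= 4 * L0 * enorm (p - q).
  apply: le_trans (ler_wpM2l (ltW t0) bpq) _.
  rewrite mulrA; apply: ler_wpM2r => //.
  have : t * (1 + P + Q) <= 4 by lra.
  by move=> /(ler_wpM2l (ltW L0_gt0)); lra.
have quad : (delta * enorm (b p - b q)) ^+ 2 <= L5 * delta * enorm (p - q) ^+ 2.
  have h1 : delta * enorm (b p - b q) <= w * (4 * L0 * enorm (p - q)).
    by rewrite -tw mulrAC mulrC ler_pM2l.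
  apply: (@le_trans _ _ ((w * (4 * L0 * enorm (p - q))) ^+ 2)).
    rewrite ler_sqr ?nnegrE//; first by apply: mulr_ge0; [exact: ltW|exact: enorm_ge0].
    apply: mulr_ge0; first exact: ltW.
    by apply: mulr_ge0 => //; apply: mulr_ge0 => //; exact: ltW.
  rewrite [(w * _) ^+ 2]exprMn [(4 * L0 * _) ^+ 2]exprMn wv mulrA; apply: ler_wpM2r; first exact: sqr_ge0.
  rewrite -mulrA mulrC ler_pM2r// -ler_pdivlMr// exprn_gt0//.
  exact: mulr_gt0.
rewrite step2 enormD_sqr innerZr enormZ (gtr0_norm delta0).
have pq2 : enorm (p - q) ^+ 2 <= enorm (x - y) ^+ 2.
  by rewrite ler_sqr ?nnegrE ?enorm_ge0.
have outcase : Rs < enorm p \/ Rs < enorm q ->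
    enorm (p - q) ^+ 2 + 2 * (delta * inner (p - q) (b p - b q)) +
    (delta * enorm (b p - b q)) ^+ 2 <= (1 - L5 * delta) * enorm (x - y) ^+ 2.
  (* Replacing |p - q| by |x - y| needs 1 - L5 delta >= 0, which is why delta is at most 1/L5. *)
  move=> /opq h; apply: (@le_trans _ _ ((1 - L5 * delta) * enorm (p - q) ^+ 2)).
    by have := ler_wpM2l (ltW delta0) h; lra.
  by apply: ler_wpM2l => //; rewrite subr_ge0.
have K0d : 0 <= (2 * M + 2 * L5) * delta * inside (Rs + 1) x.
  apply: mulr_ge0; last exact: inside_ge0.
  by apply: mulr_ge0; [lra|exact: ltW].
have xy0 : 0 <= enorm (x - y) ^+ 2 by exact: sqr_ge0.
have [pR|pR] := ltP Rs (enorm p).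
  apply: le_trans (outcase (or_introl pR)) _; apply: ler_wpM2r => //.
  by rewrite lerDl.
have [qR|qR] := ltP Rs (enorm q).
  apply: le_trans (outcase (or_intror qR)) _; apply: ler_wpM2r => //.
  by rewrite lerDl.
(* A point beyond Rs + 1 is projected to norm at least Rs + 1, so |p| <= Rs forces |x| <= Rs + 1. *)
have -> : inside (Rs + 1) x = 1.
  rewrite /inside; have -> // : `|x| <= Rs + 1.
  apply: le_trans (normr_le_enorm x) _; rewrite leNgt; apply/negP => /px2; lra.
have h1 : inner (p - q) (b p - b q) <= M * enorm (p - q) ^+ 2.
  apply: le_trans (cauchy_schwarz _ _) _.
  rewrite mulrC expr2 mulrA; apply: ler_wpM2r => //; apply: le_trans bpq _.
  apply: ler_wpM2r => //; rewrite /M ler_pM2l//.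
  by have := Ple pR; have := Qle qR; lra.
have h2 := ler_wpM2l (ltW delta0) h1.
apply: (@le_trans _ _ ((1 + 2 * M * delta + L5 * delta) * enorm (p - q) ^+ 2)).
  by lra.
have -> : 1 - L5 * delta + (2 * M + 2 * L5) * delta * 1 =
  1 + 2 * M * delta + L5 * delta by ring.
apply: ler_wpM2l => //.
have : 0 <= M * delta by rewrite mulr_ge0// ltW.
have : 0 <= L5 * delta by rewrite mulr_ge0// ltW.
lra.
Qed.

End drift.

Theorem theorem1p1 (R : realType) (d : nat) (hd : (1 <= d)%N)
    (b : 'rV[R]_d -> 'rV[R]_d) (mb : measurable_fun setT b)
    (gamma : R) (hgamma : 0 < gamma < 2^-1)
    (L0 l0 : R) (hL0 : 0 < L0) (hl0 : 0 <= l0)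
    (hb : forall x y : 'rV[R]_d,
       enorm (b x - b y) <=
       L0 * (1 + enorm x `^ l0 + enorm y `^ l0) * enorm (x - y)) :
  ((exists L1 L2 L3 L4 Rs : R,
      [/\ 0 < L1, 0 < L2, 0 < L3, 0 < L4 & 0 <= Rs] /\
      (forall x y : 'rV[R]_d,
         enorm ((enorm y `^ l0) *: b x - (enorm x `^ l0) *: b y) <=
         L1 * (1 + enorm x `^ l0 + enorm y `^ l0
               + enorm x `^ l0 * enorm y `^ l0) * enorm (x - y)) /\
      (forall x y : 'rV[R]_d, Rs < enorm x \/ Rs < enorm y ->
         inner (x - y) (b x - b y) <=
           - L2 * (1 + enorm x `^ l0 + enorm y `^ l0) * enorm (x - y) ^+ 2 /\
         inner (x - y) ((enorm y `^ l0) *: b x - (enorm x `^ l0) *: b y) <=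
           (L3 * (1 + enorm x `^ l0 + enorm y `^ l0)
            - L4 * (enorm x `^ l0) * (enorm y `^ l0)) * enorm (x - y) ^+ 2)) ->
   W2_contraction (tamed_step b gamma l0))
  /\
  ((exists Rs L5 : R,
      [/\ 0 < Rs, 0 < L5 &
          forall x y : 'rV[R]_d, Rs < enorm x \/ Rs < enorm y ->
            inner (x - y) (b x - b y) <= - L5 * enorm (x - y) ^+ 2]) ->
   W2_contraction (projected_step b gamma l0)).
Proof.
split.
- move=> [L1 [L2 [L3 [L4 [Rs [[L10 L20 L30 L40 Rs0] [h1 h2]]]]]]].
  apply: W2_contraction_of_step => //.
  + by move=> delta _ _; exact: measurable_tamed_step.
  + exact: tamed_contractive hgamma hL0 hl0 hb L1 L2 L3 L4 Rs L10 L20 L30 L40 Rs0 h1 h2.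
  + exact: tamed_confined hgamma hL0 hl0 hb.
- move=> [Rs [L5 [Rs0 L50 h]]].
  apply: W2_contraction_of_step => //.
  + move=> delta; exact: (measurable_projected_step mb hgamma hl0).
  + exact: projected_contractive hgamma hL0 hl0 hb Rs L5 Rs0 L50 h.
  + exact: projected_confined hgamma hL0 hl0 hb.
Qed.
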